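(* Let $q\ge1$, $n,m\ge1$ and $N\ge0$ be integers, let $\tau_q\ge\dots\ge\tau_1>0$ be fixed, and consider the linear time-delay system $$\dot x(t)=Ax(t)+\sum_{i=1}^qA_ix(t-\tau_i)+Bu(t),\quad y(t)=Cx(t),\quad t\ge0,\qquad x(t)=\phi(t),\ t\in[-\tau_q,0],$$ with $A,A_1,\dots,A_q\in\mathbb{R}^{n\times n}$, $B\in\mathbb{R}^{n\times m}$, $C\in\mathbb{R}^{m\times n}$. Let $$s(y,u)=\begin{bmatrix}y\\ u\end{bmatrix}^\top\begin{bmatrix}S_{11}&S_{12}\\S_{12}^\top&S_{22}\end{bmatrix}\begin{bmatrix}y\\ u\end{bmatrix},\qquad S_{11}=S_{11}^\top,\ S_{22}=S_{22}^\top,\ S_{11},S_{12},S_{22}\in\mathbb{R}^{m\times m}.$$ If there exist symmetric positive semidefinite matrices $\Theta_i,R_i\in\mathbb{R}^{n\times n}$, $i=1,\dots,q$, and a symmetric positive semidefinite $\tilde P_N\in\mathbb{R}^{n(qN+1)\times n(qN+1)}$ such that $$2\,\mathrm{sym}(\tilde G_N^\top\tilde P_N\tilde H_N)+M_0+M_{1,\tau}-\mathbf{\Gamma}_N^\top\mathbf{R}_N\mathbf{\Gamma}_N\le0$$ (negative semidefinite), with the matrices $\tilde G_N,\tilde H_N,M_0,M_{1,\tau},\mathbf{\Gamma}_N,\mathbf{R}_N$ defined in the context, then the system is dissipative with respect to the supply rate $s$.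
   Context: Notation: $\mathrm{sym}(A)=\frac12(A+A^\top)$; $\mathrm{diag}$ denotes block-diagonal matrices; $x_t(\theta)=x(t+\theta)$ for $\theta\in[-\tau_q,0]$. Dissipativity: The system is dissipative with respect to a continuous supply rate $s:\mathbb{R}^m\times\mathbb{R}^m\to\mathbb{R}$ if there is a storage functional $\mathcal{S}$ with values in $[0,\infty)$ and $\mathcal{S}(0)=0$, defined on the continuous, piecewise continuously differentiable functions $[-\tau_q,0]\to\mathbb{R}^n$, such that $$\mathcal{S}(x_{t_1})-\mathcal{S}(x_{t_0})\le\int_{t_0}^{t_1}s(y(r),u(r))\,dr\qquad\text{for all }0\le t_0\le t_1<\infty,$$ for every initial history $\phi\in C^1([-\tau_q,0],\mathbb{R}^n)$, every continuous input $u:[0,\infty)\to\mathbb{R}^m$ and every corresponding solution $x:[-\tau_q,\infty)\to\mathbb{R}^n$ (continuous, equal to $\phi$ on $[-\tau_q,0]$, continuously differentiable on $[0,\infty)$ with one-sided derivative at $0$, and satisfying the system equations for $t\ge0$), with output $y$. Matrices. Vectors in $\mathbb{R}^{n(1+q+qN)+m}$ are partitioned as $$\tilde\zeta=\big[x_0^\top\ x_1^\top\cdots x_q^\top\ (\omega^1_0)^\top\cdots(\omega^1_{N-1})^\top\ \cdots\ (\omega^q_0)^\top\cdots(\omega^q_{N-1})^\top\ u^\top\big]^\top,\quad x_i,\omega^i_k\in\mathbb{R}^n,\ u\in\mathbb{R}^m.$$ The $4\times4$ block matrices below are partitioned according to the groups $x_0$ (size $n$), $(x_1,\dots,x_q)$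 (size $qn$), $(\omega^i_k)$ (size $qnN$), $u$ (size $m$). For integers $0\le k\le N$, $0\le j\le N-1$ set $\gamma^j_{Nk}=-(2j+1)(1-(-1)^{k+j})$ if $j\le k$ and $\gamma^j_{Nk}=0$ if $j>k$. For $1\le i\le q$, $0\le k\le N$, let $\tilde\Gamma_{N,i}(k)\in\mathbb{R}^{n\times(n(1+q+qN)+m)}$ be the block row determined by $$\tilde\Gamma_{N,i}(k)\tilde\zeta=x_0+(-1)^{k+1}x_i+\sum_{j=0}^{N-1}\gamma^j_{Nk}\,\omega^i_j$$ (for $N=0$: $\tilde\Gamma_{0,i}(0)\tilde\zeta=x_0-x_i$); in particular its $u$-columns are zero. Let $\Gamma_{N,i}$ be the vertical stack of $\tilde\Gamma_{N,i}(0),\dots,\tilde\Gamma_{N,i}(N)$, $\mathbf{\Gamma}_N$ the vertical stack of $\Gamma_{N,1},\dots,\Gamma_{N,q}$, $R_{N,i}=\mathrm{diag}(R_i,3R_i,\dots,(2N+1)R_i)$ and $\mathbf{R}_N=\mathrm{diag}(R_{N,1},\dots,R_{N,q})$. Further, $$\tilde G_N=\begin{bmatrix}I_n&0&0&0\\0&0&\mathrm{diag}(\tau_1I_{nN},\dots,\tau_qI_{nN})&0\end{bmatrix},$$ and $\tilde H_N$ is the vertical stack of $F:=\begin{bmatrix}A&A_1&\cdots&A_q&0&B\end{bmatrix}$ (so $F\tilde\zeta=Ax_0+\sum_iA_ix_i+Bu$) and $\tilde\Gamma_{N,1}(0),\dots,\tilde\Gamma_{N,1}(N-1),\tilde\Gamma_{N,2}(0),\dots,\tilde\Gamma_{N,q}(N-1)$.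 For $N=0$ the $\omega$-blocks are absent, $\tilde G_0=[I_n\ 0\ \cdots\ 0]$ and $\tilde H_0=F$. Finally, $$M_0=\begin{bmatrix}\sum_{i=1}^q\Theta_i-C^\top S_{11}C&0&0&-C^\top S_{12}\\0&-\mathrm{diag}(\Theta_1,\dots,\Theta_q)&0&0\\0&0&0&0\\-S_{12}^\top C&0&0&-S_{22}\end{bmatrix},\qquad M_{1,\tau}=F^\top\Big(\sum_{i=1}^q\tau_i^2R_i\Big)F.$$ *)

(* Defs.v *)
From HB Require Import structures.
From mathcomp Require Import all_boot all_order all_algebra.
From mathcomp Require Import all_classical all_reals all_analysis.

Set Implicit Arguments.
Unset Strict Implicit.
Unset Printing Implicit Defensive.

Import Order.TTheory GRing.Theory Num.Theory.
Import numFieldNormedType.Exports.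

Local Open Scope classical_set_scope.
Local Open Scope ring_scope.

(** * Symmetric and semidefinite matrices *)

Definition symmx (R : realType) d (M : 'M[R]_d) : 'M[R]_d :=
  2^-1 *: (M + M^T).

Definition psdmx (R : realType) d (M : 'M[R]_d) : Prop :=
  M^T = M /\ forall v : 'cV[R]_d, 0 <= (v^T *m M *m v) 0 0.

Definition nsdmx (R : realType) d (M : 'M[R]_d) : Prop :=
  M^T = M /\ forall v : 'cV[R]_d, (v^T *m M *m v) 0 0 <= 0.

(** * Continuously and piecewise continuously differentiable curves *)

(* The limit is taken inside [D], so that the derivative is one-sided at the
   endpoints of an interval [D] (and two-sided at its interior points). *)
Definition is_derive_in (R : realType) n (D : set R) (f : R -> 'cV[R]_n)
    (t : R) (l : 'cV[R]_n) : Prop :=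
  (s - t)^-1 *: (f s - f t) @[s --> within D t^'] --> l.

Definition C1_on (R : realType) n (D : set R) (f : R -> 'cV[R]_n) : Prop :=
  exists2 g : R -> 'cV[R]_n,
    {within D, continuous g} & forall t, D t -> is_derive_in D f t (g t).

(* [s] lists the points t_1 < ... < t_p of a subdivision
   a = t_0 < t_1 < ... < t_p = b; [f] is C^1 on each closed piece, with
   one-sided derivatives at the endpoints of that piece. *)
Definition piecewise_C1 (R : realType) n (a b : R) (f : R -> 'cV[R]_n) : Prop :=
  exists s : seq R,
    [/\ path <%R a s, last a s = b &
        forall k, (k < size s)%N -> C1_on `[nth b (a :: s) k, nth b s k] f].

(** * Linear systems with delays [tau 0 <= ... <= tau q], [q.+1] in number *)

Definition admissible_history (R : realType) n (h : R) (f : R -> 'cV[R]_n) :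
    Prop :=
  {within `[- h, 0], continuous f} /\ piecewise_C1 (- h) 0 f.

(* Histories are total functions on [R] of which only the restriction to
   [-h, 0] is meaningful; the last condition says that [S] is a functional of
   that restriction. *)
Definition storage_functional (R : realType) n (h : R)
    (S : (R -> 'cV[R]_n) -> R) : Prop :=
  [/\ forall f, admissible_history h f -> 0 <= S f,
      S (fun=> 0) = 0 &
      forall f g, admissible_history h f -> admissible_history h g ->
        {in `[- h, 0], f =1 g} -> S f = S g].

Definition delay_solution (R : realType) q n m (tau : 'I_q.+1 -> R)
    (A : 'M[R]_n) (Ad : 'I_q.+1 -> 'M[R]_n) (B : 'M[R]_(n, m))
    (phi : R -> 'cV[R]_n) (u : R -> 'cV[R]_m) (x : R -> 'cV[R]_n) : Prop :=
  [/\ {within `[- tau ord_max, +oo[, continuous x},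
      {in `[- tau ord_max, 0], x =1 phi},
      C1_on `[0, +oo[ x &
      forall t : R, 0 <= t ->
        is_derive_in `[0, +oo[ x t
          (A *m x t + \sum_i Ad i *m x (t - tau i) + B *m u t)].

Definition dissipative (R : realType) q n m (tau : 'I_q.+1 -> R)
    (A : 'M[R]_n) (Ad : 'I_q.+1 -> 'M[R]_n) (B : 'M[R]_(n, m))
    (C : 'M[R]_(m, n)) (s : 'cV[R]_m -> 'cV[R]_m -> R) : Prop :=
  continuous (fun yu : 'cV[R]_m * 'cV[R]_m => s yu.1 yu.2) /\
  exists S : (R -> 'cV[R]_n) -> R,
    storage_functional (tau ord_max) S /\
    forall (phi : R -> 'cV[R]_n) (u : R -> 'cV[R]_m) (x : R -> 'cV[R]_n),
      C1_on `[- tau ord_max, 0] phi ->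
      {within `[0, +oo[, continuous u} ->
      delay_solution tau A Ad B phi u x ->
      forall t0 t1 : R, 0 <= t0 -> t0 <= t1 ->
        S (fun theta => x (t1 + theta)) - S (fun theta => x (t0 + theta)) <=
        \int[lebesgue_measure]_(r in `[t0, t1]) s (C *m x r) (u r).

Definition quadratic_supply (R : realType) m (S11 S12 S22 : 'M[R]_m)
    (y u : 'cV[R]_m) : R :=
  ((col_mx y u)^T *m block_mx S11 S12 S12^T S22 *m col_mx y u) 0 0.

(** * The matrices of the linear matrix inequality *)

(* Sizes qn, qnN and q(N+1)n, written as iterated sums so that the blocks are
   indexed by [i < q] and then [k < N]. Indices start at 0: the
   delay index [i : 'I_q] stands for the (i+1)-st delay. *)
Notation delay_dim q n := (\sum_(i < q) n)%N.
Notation omega_dim q N n := (\sum_(i < q) \sum_(k < N) n)%N.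
Notation zeta_dim q N n m :=
  (n + (delay_dim q n + (omega_dim q N n + m)))%N.

Definition row4_mx (R : realType) r n1 n2 n3 n4 (X1 : 'M[R]_(r, n1))
    (X2 : 'M[R]_(r, n2)) (X3 : 'M[R]_(r, n3)) (X4 : 'M[R]_(r, n4)) :
    'M[R]_(r, n1 + (n2 + (n3 + n4))) :=
  row_mx X1 (row_mx X2 (row_mx X3 X4)).

Definition col4_mx (R : realType) r n1 n2 n3 n4 (X1 : 'M[R]_(n1, r))
    (X2 : 'M[R]_(n2, r)) (X3 : 'M[R]_(n3, r)) (X4 : 'M[R]_(n4, r)) :
    'M[R]_(n1 + (n2 + (n3 + n4)), r) :=
  col_mx X1 (col_mx X2 (col_mx X3 X4)).

Definition gamma_coef (R : realType) (k j : nat) : R :=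
  if (j <= k)%N then - ((2 * j + 1)%:R * (1 - (-1) ^+ (k + j))) else 0.

Definition Gamma_row (R : realType) q n m N (i : 'I_q) (k : nat) :
    'M[R]_(n, zeta_dim q N n m) :=
  row4_mx 1%:M
    (\mxrow_(j < q) (if j == i then ((-1) ^+ k.+1)%:M else 0 : 'M[R]_n))
    (\mxrow_(j < q) \mxrow_(l < N)
       (if j == i then (gamma_coef R k l)%:M else 0 : 'M[R]_n))
    0.

Definition Gamma_mx (R : realType) q n m N :
    'M[R]_(omega_dim q N.+1 n, zeta_dim q N n m) :=
  \mxcol_(i < q) \mxcol_(k < N.+1) Gamma_row R n m N i k.

Definition Rdiag_mx (R : realType) q n N (Rm : 'I_q -> 'M[R]_n) :
    'M[R]_(omega_dim q N.+1 n) :=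
  \mxdiag_(i < q) \mxdiag_(k < N.+1) ((2 * k + 1)%:R *: Rm i).

Definition F_mx (R : realType) q n m N (A : 'M[R]_n) (Ad : 'I_q -> 'M[R]_n)
    (B : 'M[R]_(n, m)) : 'M[R]_(n, zeta_dim q N n m) :=
  row4_mx A (\mxrow_(i < q) Ad i) 0 B.

Definition G_mx (R : realType) q n m N (tau : 'I_q -> R) :
    'M[R]_(n + omega_dim q N n, zeta_dim q N n m) :=
  col_mx (row4_mx 1%:M 0 0 0)
         (row4_mx 0 0 (\mxdiag_(i < q) ((tau i)%:M : 'M[R]_(\sum_(k < N) n))) 0).

Definition H_mx (R : realType) q n m N (A : 'M[R]_n) (Ad : 'I_q -> 'M[R]_n)
    (B : 'M[R]_(n, m)) : 'M[R]_(n + omega_dim q N n, zeta_dim q N n m) :=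
  col_mx (F_mx N A Ad B)
         (\mxcol_(i < q) \mxcol_(k < N) Gamma_row R n m N i k).

Definition M0_mx (R : realType) q n m N (Theta : 'I_q -> 'M[R]_n)
    (C : 'M[R]_(m, n)) (S11 S12 S22 : 'M[R]_m) : 'M[R]_(zeta_dim q N n m) :=
  col4_mx
    (row4_mx (\sum_i Theta i - C^T *m S11 *m C) 0 0 (- (C^T *m S12)))
    (row4_mx 0 (- \mxdiag_(i < q) Theta i) 0 0)
    0
    (row4_mx (- (S12^T *m C)) 0 0 (- S22)).

Definition M1_mx (R : realType) q n m N (tau : 'I_q -> R) (A : 'M[R]_n)
    (Ad : 'I_q -> 'M[R]_n) (B : 'M[R]_(n, m)) (Rm : 'I_q -> 'M[R]_n) :
    'M[R]_(zeta_dim q N n m) :=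
  (F_mx N A Ad B)^T *m (\sum_i tau i ^+ 2 *: Rm i) *m F_mx N A Ad B.

(* Main.v *)
(* With Omega_k the k-th Legendre moment of x' on the delay interval [t - tau_i, t],
   integration by parts expresses Omega_k through x(t), x(t - tau_i) and the
   moments omega^i_j of x. Up to the boundary terms, these govern the derivative of
   the storage functional
     xi^T P xi + sum_i int_[-tau_i, 0] f^T Theta_i f
               + sum_i tau_i int_[-tau_i, 0] (tau_i + s) f'(s)^T R_i f'(s) ds,
   where xi = (f(0), tau_i omega^i_k). Bessel's inequality
     sum_(k <= N) (2 k + 1) Omega_k^T R_i Omega_k <= tau_i int x'^T R_i x'
   then bounds its derivative along a solution by the quadratic form of the
   matrix inequality at zeta(t), plus the supply rate. The derivative of a
   solution may jump at time 0, so all integrals of x' are handled through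
   continuous primitives that are differentiable away from 0. *)

Require Import Defs.
From HB Require Import structures.
From mathcomp Require Import all_boot all_order all_algebra.
From mathcomp Require Import all_classical all_reals all_analysis.
From mathcomp Require Import measurable_realfun.
From mathcomp Require Import ring lra.

Set Implicit Arguments.
Unset Strict Implicit.
Unset Printing Implicit Defensive.

Import Order.TTheory GRing.Theory Num.Theory.
Import numFieldNormedType.Exports.
Local Open Scope classical_set_scope.
Local Open Scope ring_scope.

(** * Shifted Legendre polynomials *)

Section PolyPrimitive.
Context {R : realType}.
Implicit Types (p q : {poly R}) (h : R).

(** The moment of [x] over [[t - tau_i, t]] against the [k]-th Legendre polynomial has time
    derivative exactly [Omega_k]. Hence the rows of [H_mx] below [F_mx] are rows [Gamma_row], and
    the state carries [tau_i omega^i_k] instead of [omega^i_k]. The obstacle is the energy term: its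
    window sweeps across time [0], where [r = x'^T R_i x'] may jump. With a continuous primitive
    [Pi] of [r], integration by parts turns [int (tau_i + s) r(t + s) ds] into
    [tau_i Pi(t) - int Pi(t + s) ds], which is differentiable for [t > 0]. Multiplied by [tau_i],
    its derivative is [tau_i^2 r(t) - tau_i (Pi(t) - Pi(t - tau_i))]: the first term is matched by
    [M1_mx], and Bessel's inequality bounds the increment of [Pi] from below. That inequality comes
    from the monotonicity of a continuous function whose derivative, away from the jump, is the
    quadratic form of [x'] minus its Legendre projection. *)

Definition primp p : {poly R} := \poly_(i < (size p).+1) (p`_i.-1 / i%:R).

(** At [i = 0] the right-hand side is a division by zero, hence [0]: the formula also covers the
    constant coefficient. *)
Lemma coef_primp p i : (primp p)`_i = p`_i.-1 / i%:R.
Proof.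
rewrite coef_poly; case: ltnP => // lt_pi.
by case: i lt_pi => //= i lt_pi; rewrite nth_default ?mul0r.
Qed.

Lemma deriv_primp p : (primp p)^`() = p.
Proof.
by apply/polyP => i; rewrite coef_deriv coef_primp -[_ *+ _]mulr_natr divfK ?pnatr_eq0.
Qed.

Lemma size_primp p k : (size p <= k)%N -> (size (primp p) <= k.+1)%N.
Proof. by move=> pk; rewrite (leq_trans (size_poly _ _)). Qed.

Lemma primp_deriv p : primp p^`() = p - (p.[0])%:P.
Proof.
apply/polyP => -[|i]; rewrite coef_primp coefB coefC ?horner_coef0 /=.
  by rewrite invr0 mulr0 subrr.
by rewrite coef_deriv -[_ *+ _]mulr_natr mulfK ?pnatr_eq0// subr0.
Qed.

(** The integral of [p] over [[0, h]], kept formal so that orthogonality is pure polynomial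
    algebra. *)
Definition intp h p := (primp p).[h].

Lemma primp_is_linear : linear primp.
Proof.
move=> a p q; apply/polyP => i.
by rewrite coefD coefZ !coef_primp coefD coefZ mulrDl mulrA.
Qed.

Lemma intpD h p q : intp h (p + q) = intp h p + intp h q.
Proof. by rewrite /intp -[p]scale1r primp_is_linear !scale1r hornerD. Qed.

Lemma intp0 h : intp h 0 = 0.
Proof. by apply: (addrI (intp h 0)); rewrite -intpD !addr0. Qed.

Lemma intpZ h a p : intp h (a *: p) = a * intp h p.
Proof.
rewrite -[a *: p]addr0 /intp primp_is_linear hornerD hornerZ.
by rewrite -/(intp h 0) intp0 addr0.
Qed.

Lemma intpB h p q : intp h (p - q) = intp h p - intp h q.
Proof. by rewrite intpD -[- q]scaleN1r intpZ mulN1r. Qed.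

Lemma intp_deriv h p : intp h p^`() = p.[h] - p.[0].
Proof. by rewrite /intp primp_deriv !hornerE. Qed.

Lemma primp_horner0 p : (primp p).[0] = 0.
Proof. by rewrite horner_coef0 coef_primp invr0 mulr0. Qed.

Lemma intp_parts h p q :
  intp h (p^`() * q) = p.[h] * q.[h] - p.[0] * q.[0] - intp h (p * q^`()).
Proof. by rewrite -!hornerM -intp_deriv -intpB derivM addrK. Qed.

End PolyPrimitive.

(** * Legendre polynomials by recursion: derivatives, norms, orthogonality *)

Section Legendre.
Context {R : realType} (h : R).
Hypothesis h0 : h != 0.

(** Carries [L_k] and [L_(k+1)] together, which makes the two-step recursion structural. Since
    [primp] vanishes at [0], a double step preserves the value at [0]. *)
Fixpoint legendre_pair k : {poly R} * {poly R} :=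
  if k is k'.+1 then
    let pq := legendre_pair k' in
    (pq.2, pq.1 + (2 * (2 * k + 1)%:R / h) *: primp pq.2)
  else (1, (2 / h) *: 'X - 1).

(* The Legendre polynomials shifted to [0, h], so that L_k(h) = 1 and
   L_k(0) = (-1)^k; they satisfy L_(k+2)' - L_k' = (2 (2k + 3) / h) L_(k+1). *)
Definition legendre k := (legendre_pair k).1.

Lemma legendre0 : legendre 0 = 1. Proof. by []. Qed.

Lemma legendre1 : legendre 1 = (2 / h) *: 'X - 1. Proof. by []. Qed.

Lemma legendreSS k : legendre k.+2 =
  legendre k + (2 * (2 * k.+1 + 1)%:R / h) *: primp (legendre k.+1).
Proof. by []. Qed.

Lemma legendre_ind (P : nat -> Prop) : P 0%N -> P 1%N ->
  (forall k, P k -> P k.+1 -> P k.+2) -> forall k, P k.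
Proof.
move=> P0 P1 PS k; suff [] : P k /\ P k.+1 by [].
by elim: k => [|k [Pk PSk]]; split => //; exact: PS.
Qed.

(** Unrolling the recursion leaves the [j] of parity opposite to [k]; the factor
    [1 - (-1) ^+ (k + j)] is [2] on these and [0] on the others. *)
Lemma deriv_legendre k : (legendre k)^`() =
  \sum_(j < k) ((2 * j + 1)%:R * (1 - (-1) ^+ (k + j)) / h) *: legendre j.
Proof.
elim/legendre_ind: k => [||k IHk _].
- by rewrite legendre0 big_ord0 derivC.
- rewrite legendre1 big_ord1 legendre0 derivB derivZ derivX derivC subr0.
  by congr (_ *: _); rewrite /= expr1; ring.
- rewrite legendreSS derivD derivZ deriv_primp !big_ord_recr /= IHk -addrA.
  congr (_ + _); first by apply: eq_bigr => j _; rewrite !addSn !exprS !mulN1r opprK.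
  rewrite -[X in X = _]add0r; congr (_ + _).
    by rewrite -signr_odd oddD /= negbK addbb subrr mulr0 mul0r scale0r.
  congr (_ *: _); rewrite -signr_odd oddD /= negbK addbN addbb /= expr1.
  by ring.
Qed.

Lemma legendre_horner0 k : (legendre k).[0] = (-1) ^+ k.
Proof.
elim/legendre_ind: k => [||k IHk _].
- by rewrite legendre0 hornerC.
- by rewrite legendre1 !hornerE; ring.
- by rewrite legendreSS hornerD hornerZ primp_horner0 mulr0 addr0 IHk !exprS
    !mulN1r opprK.
Qed.

Lemma size_legendre k : size (legendre k) = k.+1.
Proof.
elim/legendre_ind: k => [||k s0 s1].
- by rewrite legendre0 size_poly1.
- rewrite legendre1 size_polyDl size_scale ?size_polyN ?size_polyX ?size_poly1//;
  by rewrite mulf_neq0 ?invr_eq0// pnatr_eq0.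
- have c0 : 2 * (2 * k.+1 + 1)%:R / h != 0.
    by rewrite !mulf_neq0 ?invr_eq0 ?pnatr_eq0 ?addn1.
  have sP : size (primp (legendre k.+1)) = k.+3.
    apply/eqP; rewrite eqn_leq size_primp ?s1//=.
    rewrite ltnNge; apply/negP => /leq_sizeP/(_ k.+2 (leqnn _)).
    rewrite coef_primp /= => /eqP; rewrite mulf_eq0 invr_eq0 pnatr_eq0 orbF.
    have -> : (legendre k.+1)`_k.+1 = lead_coef (legendre k.+1) by rewrite lead_coefE s1.
    by rewrite lead_coef_eq0 -size_poly_eq0 s1.
  by rewrite legendreSS addrC size_polyDl size_scale ?s0 ?sP.
Qed.

(** The polynomial [X L' - k L] has degree below [k], so the integral of [L X L'] is [k] times that
    of [L^2]. Integrating [(X L^2)'] then gives [(2k + 1) int L^2 = h]. It is stated for an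
    arbitrary [L] because the induction for orthogonality already uses it. *)
Lemma normalized_orthogonal_norm k (L : {poly R}) :
    size L = k.+1 -> L.[h] = 1 ->
    (forall p : {poly R}, (size p <= k)%N -> intp h (L * p) = 0) ->
  intp h (L * L) = h / (2 * k + 1)%:R.
Proof.
move=> sL Lh oL.
have k0 : (2 * k + 1)%:R != 0 :> R by rewrite pnatr_eq0 addn1.
have /oL : (size ('X * L^`() - k%:R *: L)%R <= k)%N.
  apply/leq_sizeP => i; rewrite leq_eqVlt => /predU1P[<-|lt_ki].
    rewrite coefB coefXM coefZ; case: (k) => [|k'] /=; first by rewrite mul0r subrr.
    by rewrite coef_deriv mulr_natl subrr.
  rewrite coefB coefXM coefZ; case: i lt_ki => //= i; rewrite ltnS => lt_ki.
  by rewrite coef_deriv [L`__]nth_default ?sL// mul0rn mulr0 subrr.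
rewrite mulrBr -scalerAr intpB intpZ => /eqP; rewrite subr_eq0 => /eqP e1.
have : intp h ('X * (L * L))^`() = h.
  by rewrite intp_deriv !hornerM !hornerX Lh mul0r !mulr1 subr0.
rewrite derivM derivX mul1r derivM.
rewrite (_ : 'X * (L^`() * L + L * L^`()) = 2 *: (L * ('X * L^`()))); last first.
  by rewrite scaler_nat mulr2n mulrDr (mulrC _ L) -mulrCA.
rewrite intpD intpZ e1 => eh.
by apply: (mulIf k0); rewrite divfK// -[RHS]eh natrD natrM; ring.
Qed.

(** Integration by parts against the recursion settles test polynomials of degree below [k]. The two
    missing degrees are tested on [L_k] and [L_(k+1)] themselves, and every other test polynomial is
    reduced modulo these two. *)
Lemma legendre_spec k : (legendre k).[h] = 1 /\
  (
  forall p : {poly R}, (size p <= k)%N -> intp h (legendre k * p) = 0).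
Proof.
elim/legendre_ind: k => [||k [e0 o0] [e1 o1]].
- rewrite legendre0; split=> [|p]; first by rewrite hornerC.
  by rewrite leqn0 size_poly_eq0 => /eqP->; rewrite mulr0 intp0.
- rewrite legendre1; split.
  + by rewrite !hornerE divfK//; ring.
  + move=> p sp; rewrite (size1_polyC sp) mulrC mul_polyC intpZ.
    have -> : (2 / h) *: 'X - 1 = (h^-1 *: ('X * 'X) - 'X : {poly R})^`().
      rewrite derivB derivZ derivM derivX mul1r mulr1 -mulr2n.
      by rewrite -[_ *+ 2 in RHS]scaler_nat scalerA mulrC.
    by rewrite intp_deriv !hornerE /=; field.
- have s0 := size_legendre k; have s1 := size_legendre k.+1.
  set c := 2 * (2 * k.+1 + 1)%:R / h.
  have c0 : c != 0 by rewrite !mulf_neq0 ?invr_eq0 ?pnatr_eq0 ?addn1.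
  (* Orthogonality of [L_(k+1)] to [1] makes its primitive vanish at [h] as well as at [0], so the
     boundary terms below drop out. *)
  have prim1 : (primp (legendre k.+1)).[h] = 0.
    by rewrite -[LHS]/(intp h _) -[legendre k.+1]mulr1 o1// size_poly1.
  have eSS : (legendre k.+2).[h] = 1.
    by rewrite legendreSS hornerD hornerZ prim1 mulr0 addr0.
  have parts p : intp h (legendre k.+2 * p) =
      intp h (legendre k * p) - c * intp h (legendre k.+1 * primp p).
    rewrite legendreSS mulrDl intpD -scalerAl intpZ -/c -mulrN; congr (_ + _ * _).
    rewrite -[legendre k.+1 in RHS]deriv_primp intp_parts deriv_primp prim1.
    by rewrite primp_horner0 !mul0r subrr sub0r opprK.
  split=> // p sp.
  have low (q : {poly R}) : (size q <= k)%N -> intp h (legendre k.+2 * q) = 0.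
    by move=> sq; rewrite parts o0// o1 ?size_primp// mulr0 subrr.
  (* The constant of the recursion is decisive here: one step lower, the integral of [L_(k+1)] times
     the primitive of [L_k] is [n1 / c'], and [c / c' = (2k + 3) / (2k + 1)] is the ratio of the
     squared norms of [L_k] and [L_(k+1)]. *)
  have mid : intp h (legendre k.+2 * legendre k) = 0.
    have n0 := normalized_orthogonal_norm s0 e0 o0.
    have n1 := normalized_orthogonal_norm s1 e1 o1.
    have nk (j : nat) : (2 * j + 1)%:R != 0 :> R by rewrite pnatr_eq0 addn1.
    rewrite parts n0.
    pose c' : R := 2 * (2 * k + 1)%:R / h.
    have c'0 : c' != 0 by rewrite !mulf_neq0 ?invr_eq0 ?pnatr_eq0 ?addn1.
    have : exists2 q : {poly R}, (size q <= k.+1)%N &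
        legendre k.+1 = q + c' *: primp (legendre k).
      rewrite /c'; case: (k) => [|j].
        exists (- 1); first by rewrite size_polyN size_poly1.
        rewrite legendre1 legendre0 addrC; congr (_ + _).
        have -> : primp 1 = 'X :> {poly R}.
          by rewrite -(derivX R) primp_deriv hornerX subr0.
        by rewrite muln0 mulr1.
      exists (legendre j); last by rewrite legendreSS.
      by rewrite size_legendre.
    move=> [q sq eq1].
    have := n1; rewrite {2}eq1 mulrDr intpD o1// add0r -scalerAr intpZ => /eqP.
    rewrite -(inj_eq (mulfI (invr_neq0 c'0))) mulKf// => /eqP ->.
    rewrite /c /c'.
    have := nk k; have := nk k.+1; move: (2 * k + 1)%N (2 * k.+1 + 1)%N => a b a0 b0.
    by field; rewrite h0 a0 b0.
  (* A polynomial times its own primitive is half the derivative of the squared primitive, which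
     vanishes at both ends. *)
  have top : intp h (legendre k.+2 * legendre k.+1) = 0.
    rewrite legendreSS mulrDl intpD -scalerAl intpZ mulrC o1 ?s0// add0r.
    rewrite (_ : _ * _ = 2^-1 *: (primp (legendre k.+1) * primp (legendre k.+1))^`()).
      by rewrite intpZ intp_deriv !hornerM prim1 primp_horner0 mulr0 subrr !mulr0.
    rewrite derivM deriv_primp [_ * primp _]mulrC -mulr2n -[X in _ *: X]scaler_nat.
    by rewrite scalerA mulVf ?pnatr_eq0// scale1r.
  (* Subtracting the multiple of [L] that cancels the coefficient of degree [j] leaves the integral
     unchanged. *)
  have reduce j (L : {poly R}) (q : {poly R}) : size L = j.+1 -> (size q <= j.+1)%N ->
      intp h (legendre k.+2 * L) = 0 ->
      exists2 r : {poly R}, (size r <= j)%N &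
        intp h (legendre k.+2 * q) = intp h (legendre k.+2 * r).
    move=> sL sq oL; exists (q - (q`_j / L`_j) *: L).
      apply/leq_sizeP => i; rewrite leq_eqVlt => /predU1P[<-|lt_ji].
        rewrite coefB coefZ divfK ?subrr// -[j]/(j.+1.-1) -sL -lead_coefE.
        by rewrite lead_coef_eq0 -size_poly_eq0 sL.
      rewrite coefB coefZ [q`_i]nth_default ?(leq_trans sq)//.
      by rewrite [L`_i]nth_default ?sL// mulr0 subrr.
    by rewrite mulrBr intpB -scalerAr intpZ oL mulr0 subr0.
  have [r sr ->] := reduce _ _ _ s1 sp top.
  have [r' sr' ->] := reduce _ _ _ s0 sr mid.
  exact: low.
Qed.

Lemma legendre_orthogonal i j : intp h (legendre i * legendre j) =
  if i == j then h / (2 * i + 1)%:R else 0.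
Proof.
wlog le_ji : i j / (j <= i)%N => [H|].
  by case: (leqP j i) => [/H//|/ltnW/H]; rewrite mulrC eq_sym; case: eqP => // ->.
have [ei oi] := legendre_spec i.
case: eqVneq => [<-|neq_ij]; first exact: normalized_orthogonal_norm (size_legendre i) ei oi.
by rewrite oi// size_legendre ltn_neqAle eq_sym neq_ij.
Qed.

(** The two conventions agree at [j = k], where [gamma_coef] vanishes by parity, and [gamma_coef] is
    [0] beyond; the sum may thus run up to any [N >= k]. *)
Lemma deriv_legendre_gamma N k : (k <= N)%N -> (legendre k)^`() =
  - (h^-1 *: \sum_(j < N) gamma_coef R k j *: legendre j).
Proof.
move=> le_kN; rewrite deriv_legendre (big_ord_widen N
  (fun j => ((2 * j + 1)%:R * (1 - (-1) ^+ (k + j)) / h) *: legendre j) le_kN).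
rewrite scaler_sumr -sumrN big_mkcond; apply: eq_bigr => j _ /=.
rewrite scalerA -scaleNr /gamma_coef; case: ltngtP => [lt_jk|_|->] //.
- by rewrite mulrN opprK mulrC.
- by rewrite mulr0 oppr0 scale0r.
- by rewrite -signr_odd oddD addbb subrr mulr0 oppr0 mulr0 oppr0 scale0r.
Qed.

End Legendre.

(** * One-variable calculus *)

Section Calculus.
Context {R : realType}.
Notation mu := (@lebesgue_measure R).
Implicit Types (f F : R -> R) (a b c t : R).

Lemma is_derive_continuous f t d : is_derive t 1 f d -> {for t, continuous f}.
Proof. by move=> [df _]; apply/differentiable_continuous/derivable1_diffP. Qed.

Lemma derive_le F f a b : a <= b -> continuous F ->
  (forall s, a < s < b -> is_derive s 1 F (f s)) ->
  (forall s, a < s < b -> f s <= 0) -> F b <= F a.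
Proof.
move=> ab cF dF f0; apply: (@ler0_derive1_nincr R F a b) => //.
- by move=> x; rewrite in_itv /= => /dF[].
- by move=> x; rewrite in_itv /= => xab; have [_] := dF _ xab; rewrite derive1E => ->; exact: f0.
- exact: continuous_subspaceT.
Qed.

Lemma continuous_integrable_itv f a b : continuous f ->
  mu.-integrable `[a, b] (EFin \o f).
Proof.
move=> cf; apply: continuous_compact_integrable; first exact: segment_compact.
exact: continuous_subspaceT.
Qed.

Lemma continuous_Rintegral f F a b : a <= b -> continuous f -> continuous F ->
  (forall s, a < s < b -> is_derive s 1 F (f s)) ->
  \int[mu]_(s in `[a, b]) f s = F b - F a.
Proof.
move=> + cf cF dF; rewrite le_eqVlt => /predU1P[<-|ab].
  by rewrite set_itv1 Rintegral_set1 subrr.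
rewrite /Rintegral (@continuous_FTC2 _ f F)//.
- exact: continuous_subspaceT.
- split; first by move=> x; rewrite in_itv /= => /dF[].
    exact/cvg_at_right_filter/cF.
  exact/cvg_at_left_filter/cF.
- by move=> x; rewrite in_itv /= => /dF[_]; rewrite derive1E.
Qed.

Lemma integrable_setU f (A B : set R) : measurable A -> measurable B ->
  mu.-integrable A (EFin \o f) -> mu.-integrable B (EFin \o f) -> A `&` B = set0 ->
  mu.-integrable (A `|` B) (EFin \o f).
Proof.
move=> mA mB /integrableP[mfA iA] /integrableP[mfB iB] AB0.
have mf := (measurable_funU _ mA mB).2 (conj mfA mfB).
apply/integrableP; split=> //.
rewrite ge0_integral_setU//.
- exact: lte_add_pinfty.
- exact: measurableT_comp.
- by apply/disj_set2P.
Qed.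

(** The value of [f] at the jump [c] is arbitrary, since [[set c]] is null, and continuity of [F]
    glues the increments on both sides. The point [c] may also lie outside the interval. *)
Lemma piecewise_Rintegral f f1 f2 F a b c : a <= b ->
  continuous f1 -> continuous f2 -> continuous F ->
  (forall s, a < s < b -> s < c -> f s = f1 s /\ is_derive s 1 F (f1 s)) ->
  (forall s, a < s < b -> c < s -> f s = f2 s /\ is_derive s 1 F (f2 s)) ->
  \int[mu]_(s in `]a, b[) f s = F b - F a.
Proof.
move=> ab cf1 cf2 cF H1 H2.
have oo (u v : R) (g h : R -> R) : u <= v -> continuous g -> {in `]u, v[, h =1 g} ->
    (forall s, u < s < v -> is_derive s 1 F (g s)) ->
    mu.-integrable `]u, v[ (EFin \o h) /\ \int[mu]_(s in `]u, v[) h s = F v - F u.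
  move=> uv cg hg dF.
  have ig : mu.-integrable `]u, v[ (EFin \o g).
    apply: integrableS (continuous_integrable_itv u v cg) => //.
    exact: subset_itv_oo_cc.
  split.
    apply: eq_integrable ig => //= x; rewrite inE /= => xuv.
    by rewrite hg// inE.
  rewrite (@eq_Rintegral _ _ _ mu _ g); last by move=> x; rewrite inE => /hg.
  rewrite -(continuous_Rintegral uv cg cF dF) /Rintegral; congr fine.
  by rewrite -(@integral_itv_bndoo _ u v _ true false)//; exact: measurable_int ig.
have [ac|ca] := leP c a.
  apply: (oo a b f2 f ab cf2 _ _).2 => s; rewrite ?in_itv /=.
    by move=> sab; case: (H2 s) => //; case/andP: sab => ? _; exact: le_lt_trans ac _.
  by move=> sab; case: (H2 s) => //; case/andP: sab => ? _; exact: le_lt_trans ac _.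
have [bc|cb] := leP b c.
  apply: (oo a b f1 f ab cf1 _ _).2 => s; rewrite ?in_itv /=.
    by move=> sab; case: (H1 s) => //; case/andP: sab => _ ?; exact: lt_le_trans bc.
  by move=> sab; case: (H1 s) => //; case/andP: sab => _ ?; exact: lt_le_trans bc.
have [i1 e1] : mu.-integrable `]a, c[ (EFin \o f) /\
    \int[mu]_(s in `]a, c[) f s = F c - F a.
  apply: (oo a c f1 f (ltW ca) cf1) => s; rewrite ?in_itv /= => /andP[as_ sc];
    by case: (H1 s) => //; rewrite as_ (lt_trans sc).
have [i2 e2] : mu.-integrable `]c, b[ (EFin \o f) /\
    \int[mu]_(s in `]c, b[) f s = F b - F c.
  apply: (oo c b f2 f (ltW cb) cf2) => s; rewrite ?in_itv /= => /andP[cs sb];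
    by case: (H2 s) => //; rewrite sb (lt_trans ca).
have ic : mu.-integrable [set c] (EFin \o f).
  apply/integrableP; split; first exact: measurable_fun_set1.
  by rewrite integral_set1.
have di1 : `]a, c[ `&` [set c] = set0.
  by apply/seteqP; split=> x //= [] + ex; rewrite ex in_itv /= ltxx andbF.
have dic : (`]a, c[ `|` [set c]) `&` `]c, b[ = set0.
  apply/seteqP; split=> x //= [] [|->] /=; rewrite !in_itv /= ?ltxx// => /andP[_ xc].
  by rewrite ltNge (ltW xc).
have mc : measurable (`]a, c[ `|` [set c] : set R) by exact: measurableU.
have i1c : mu.-integrable (`]a, c[ `|` [set c]) (EFin \o f).
  exact: integrable_setU.
have -> : `]a, b[%classic = (`]a, c[ `|` [set c]) `|` `]c, b[.
  apply/seteqP; split=> x /=; rewrite !in_itv /=.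
    move=> /andP[ax xb]; case: (ltgtP x c) => xc.
    - by left; left; rewrite ax.
    - by right.
    - by left; right.
  case=> [[/andP[-> xc]|->]|/andP[cx ->]].
  - exact: lt_trans xc cb.
  - by rewrite ca.
  - by rewrite (lt_trans ca).
rewrite Rintegral_setU//; last 2 first.
- exact: integrable_setU.
- by apply/disj_set2P.
rewrite Rintegral_setU//; last by apply/disj_set2P.
by rewrite Rintegral_set1 addr0 e1 e2 addrC subrKA.
Qed.

(** Integration from a fixed lower bound gives a primitive only to the right of that bound. For the
    whole line, [f t] is written as [f (max t 0) + f (min t 0) - f 0], whose first two terms are
    constant on one half-line each. *)
Lemma primitive_exists f : continuous f ->
  exists F, forall t, is_derive t 1 F (f t).
Proof.
move=> cf.
(* On the half-line where [g] is constant the primitive is affine. Starting the integral at [-1]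
   makes every [t >= 0] an interior point, and the two formulas agree on []-1, 0[]. *)
have half (g : R -> R) : continuous g -> (forall t, t <= 0 -> g t = g 0) ->
    exists F, forall t, is_derive t 1 F (g t).
  move=> cg g0; pose F y := \int[mu]_(s in `[-1, y]) g s.
  have dlin t : is_derive t 1 (fun y => g 0 * (y + 1)) (g 0).
    have -> : (fun y => g 0 * (y + 1)) = g 0 *: (id + cst 1).
      by apply/funext => y.
    by apply: is_derive_eq; rewrite addr0 -[RHS]mulr1.
  exists (fun y => if y < 0 then g 0 * (y + 1) else F y) => t.
  have [t0|t0] := ltP t 0.
    rewrite g0 ?(ltW t0)//; apply: near_eq_is_derive (dlin t).
    by near=> y; rewrite ifT//; near: y; exact: lt_nbhsl.
  have t1 : -1 < t by rewrite (lt_le_trans _ t0)// ltrN10.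
  have dF : is_derive t 1 F (g t).
    have [] := @continuous_FTC1_closed _ g (-1) t (t + 1) _ _ _ _ => //.
    - by rewrite ltrDl.
    - exact: continuous_integrable_itv.
    - exact: cg.
    by move=> d1 d2; apply: DeriveDef => //; rewrite -derive1E.
  apply: near_eq_is_derive dF; near=> y.
  have y1 : -1 < y by near: y; exact: lt_nbhsr.
  case: ltP => // y0.
  rewrite /F (@eq_Rintegral _ _ _ mu _ (cst (g 0))).
    rewrite (@continuous_Rintegral _ (fun y => g 0 * (y + 1))) ?(ltW y1)//.
    - by rewrite addNr mulr0 subr0.
    - by move=> ?; exact: cst_continuous.
    - by move=> s; apply: is_derive_continuous (dlin s).
  move=> s; rewrite inE /= in_itv /= => /andP[_ sy].
  by rewrite g0// (le_trans sy)// ltW.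
have [|t t0|F1 dF1] := half (fun t => f (Num.max t 0)).
- move=> s; apply: (@continuous_comp _ _ _ (fun t => Num.max t 0)); last exact: cf.
  by apply: continuous_max => //; exact: cst_continuous.
- by rewrite !max_r.
have [|t t0|F2 dF2] := half (fun t => f (Num.min (- t) 0)).
- move=> s; apply: (@continuous_comp _ _ _ (fun t => Num.min (- t) 0)); last exact: cf.
  by apply: continuous_min; [exact: opp_continuous|exact: cst_continuous].
- by rewrite oppr0 !min_r// oppr_ge0.
exists (fun t => F1 t - F2 (- t) - f 0 * t) => t.
have d2 : is_derive t 1 (fun y => F2 (- y)) (f (Num.min t 0) * -1).
  by apply: (@is_derive1_comp _ F2 -%R); rewrite -{2}[t]opprK.
have dl : is_derive t 1 (fun y => f 0 * y) (f 0).
  have -> : (fun y => f 0 * y) = f 0 *: id by apply/funext => y.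
  by apply: is_derive_eq; rewrite -[RHS]mulr1.
apply: is_derive_eq.
rewrite mulrN1 opprK; have [t0|t0] := leP t 0.
  by rewrite addrAC subrr add0r.
by rewrite addrK.
Unshelve. all: by end_near. Qed.

End Calculus.

(** * Moments over a sliding window *)

Section Window.
Context {R : realType}.
Notation mu := (@lebesgue_measure R).
Implicit Types (f F g r P Q Z : R -> R) (p q : {poly R}) (h s t : R).

(** The shift by [h] carries [[- h, 0]] onto [[0, h]], where the polynomials are orthogonal. *)
Definition moment h p f := \int[mu]_(s in `[- h, 0]) (p.[h + s] * f s).

Lemma eq_moment h p f g : {in `[- h, 0], f =1 g} -> moment h p f = moment h p g.
Proof.
by move=> fg; apply: eq_Rintegral => s; rewrite inE /= => hs; rewrite fg// inE.
Qed.

Lemma is_derive_translate f t h d : is_derive (t + h) 1 f d ->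
  is_derive h 1 (fun s => f (t + s)) d.
Proof.
move=> df; rewrite -[d]mulr1; apply: (@is_derive1_comp _ f (fun s => t + s)) => //.
have -> : (fun s => t + s) = cst t + id by [].
by apply: is_derive_eq; rewrite add0r.
Qed.

Lemma is_derive_horner_shift p h t :
  is_derive t 1 (fun s => p.[h + s]) p^`().[h + t].
Proof. by apply: (@is_derive_translate (horner p)); exact: is_derive_poly. Qed.

Lemma continuous_translate f t : continuous f -> continuous (fun s => f (t + s)).
Proof.
move=> cf s; apply: (@continuous_comp _ _ _ (fun s => t + s)); last exact: cf.
by apply: continuousD => //; exact: cst_continuous.
Qed.

Lemma continuous_horner_shift p h : continuous (fun s => p.[h + s]).
Proof. by move=> s; apply: is_derive_continuous (is_derive_horner_shift p h s). Qed.

Lemma continuous_mul (T : topologicalType) (f g : T -> R) :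
  continuous f -> continuous g -> continuous (fun z => f z * g z).
Proof. by move=> cf cg z; exact: (continuousM (cf z) (cg z)). Qed.

Lemma moment_parts h p f F : 0 <= h -> continuous f ->
    (forall s : R, is_derive s 1 F (f s)) ->
  moment h p f = p.[h] * F 0 - p.[0] * F (- h) - moment h p^`() F.
Proof.
move=> h0 cf dF.
have cF : continuous F by move=> s; apply: is_derive_continuous (dF s).
have cg : continuous (fun s => p^`().[h + s] * F s).
  by apply: continuous_mul => //; exact: continuous_horner_shift.
have [Z dZ] := primitive_exists cg.
have cZ : continuous Z by move=> s; apply: is_derive_continuous (dZ s).
have dG (s : R) : is_derive s 1 (fun s : R => p.[h + s] * F s - Z s) (p.[h + s] * f s).
  have d1 := is_derive_horner_shift p h s; have d2 := dF s; have d3 := dZ s.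
  by apply: is_derive_eq; rewrite /GRing.scale /=; ring.
rewrite /moment.
rewrite (@continuous_Rintegral _ _ (fun s => p.[h + s] * F s - Z s)) ?oppr_le0//.
- rewrite (@continuous_Rintegral _ _ Z) ?oppr_le0// addr0 subrr.
  by ring.
- by apply: continuous_mul => //; exact: continuous_horner_shift.
- by move=> s; apply: is_derive_continuous (dG s).
Qed.

Definition window h p f t := moment h p (fun s => f (t + s)).

Lemma window_parts h p f F t : 0 <= h -> continuous f ->
    (forall s : R, is_derive s 1 F (f s)) ->
  window h p f t = p.[h] * F t - p.[0] * F (t - h) - window h p^`() F t.
Proof.
move=> h0 cf dF.
have dFt (s : R) : is_derive s 1 (fun s => F (t + s)) (f (t + s)).
  by apply: is_derive_translate; exact: dF.
by rewrite /window (moment_parts p h0 (continuous_translate (t := t) cf) dFt) addr0.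
Qed.

Lemma window0 h f t : window h 0 f t = 0.
Proof.
rewrite /window /moment (@eq_Rintegral _ _ _ mu _ (cst 0)).
  by rewrite Rintegral_cst// mul0r.
by move=> s _; rewrite horner0 mul0r.
Qed.

(** Induction on the degree of [p]: integration by parts trades [p] for [p'] and [f] for a primitive
    of [f], down to [p = 0]. No derivative is taken under the integral sign, so continuity of [f]
    suffices. *)
Lemma is_derive_window h p f t : 0 <= h -> continuous f ->
  is_derive t 1 (window h p f)
    (p.[h] * f t - p.[0] * f (t - h) - window h p^`() f t).
Proof.
move=> h0; have [k] := ubnP (size p).
elim: k => // k IHk in p f t *; rewrite ltnS => sp cf.
have [p0|p0] := eqVneq p 0.
  rewrite p0 deriv0 window0 !horner0 !mul0r !subr0.
  have -> : window h 0 f = cst 0 by apply/funext => s; rewrite window0.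
  exact: is_derive_cst.
have [F dF] := primitive_exists cf.
have cF : continuous F by move=> s; apply: is_derive_continuous (dF s).
have -> : window h p f =
    fun t => p.[h] * F t - p.[0] * F (t - h) - window h p^`() F t.
  by apply/funext => s; exact: window_parts.
have dW := IHk p^`() F t (leq_trans (lt_size_deriv p0) sp) cF.
have dFh : is_derive t 1 (fun s => F (s - h)) (f (t - h)).
  under eq_fun do rewrite addrC; rewrite addrC.
  by apply: is_derive_translate; exact: dF.
rewrite (window_parts _ _ h0 cf dF).
have dFt := dF t.
have d1 : is_derive t 1 (fun s => p.[h] * F s) (p.[h] * f t) := is_deriveZ _ _.
have d2 : is_derive t 1 (fun s => p.[0] * F (s - h)) (p.[0] * f (t - h)) := is_deriveZ _ _.
exact: is_deriveB.
Qed.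

Lemma continuous_window h p f : 0 <= h -> continuous f -> continuous (window h p f).
Proof. by move=> h0 cf t; apply: is_derive_continuous (is_derive_window p t h0 cf). Qed.

Lemma windowD h p f g t : continuous f -> continuous g ->
  window h p (fun s => f s + g s) t = window h p f t + window h p g t.
Proof.
move=> cf cg; rewrite /window /moment; under eq_Rintegral do rewrite mulrDr.
rewrite RintegralD//; apply: continuous_integrable_itv; apply: continuous_mul;
  by [exact: continuous_horner_shift|exact: continuous_translate].
Qed.

Lemma windowZ h p c f t : continuous f ->
  window h p (fun s => c * f s) t = c * window h p f t.
Proof.
move=> cf; rewrite /window /moment; under eq_Rintegral do rewrite mulrCA.
rewrite RintegralZl//; apply: continuous_integrable_itv; apply: continuous_mul;
  by [exact: continuous_horner_shift|exact: continuous_translate].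
Qed.

Lemma continuous_sumr (T : topologicalType) n (F : 'I_n -> T -> R) :
  (forall i, continuous (F i)) -> continuous (fun z => \sum_i F i z).
Proof.
elim: n => [|n IHn] in F * => cF.
  by under eq_fun do rewrite big_ord0; move=> z; exact: cst_continuous.
under eq_fun do rewrite big_ord_recl.
by move=> z; apply: continuousD; [exact: cF|apply: IHn].
Qed.

Lemma window_sum n h p (F : 'I_n -> R -> R) t : (forall i, continuous (F i)) ->
  window h p (fun s => \sum_i F i s) t = \sum_i window h p (F i) t.
Proof.
elim: n => [|n IHn] in F *; move=> cF.
  rewrite big_ord0 -[RHS](mul0r (window h p (cst 1) t)) -windowZ; last first.
    by move=> s; exact: cst_continuous.
  by congr window; apply/funext => s; rewrite big_ord0 mul0r.
rewrite big_ord_recl -IHn// -windowD//; last exact: continuous_sumr.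
by congr window; apply/funext => s; rewrite big_ord_recl.
Qed.

Lemma window_polyD h p q f t : continuous f ->
  window h (p + q) f t = window h p f t + window h q f t.
Proof.
move=> cf; rewrite /window /moment; under eq_Rintegral do rewrite hornerD mulrDl.
rewrite RintegralD//; apply: continuous_integrable_itv; apply: continuous_mul;
  by [exact: continuous_horner_shift|exact: continuous_translate].
Qed.

Lemma window_polyZ h c p f t : continuous f ->
  window h (c *: p) f t = c * window h p f t.
Proof.
move=> cf; rewrite /window /moment; under eq_Rintegral do rewrite hornerZ -mulrA.
rewrite RintegralZl//; apply: continuous_integrable_itv; apply: continuous_mul;
  by [exact: continuous_horner_shift|exact: continuous_translate].
Qed.

Lemma window_poly_sum n h (p : 'I_n -> {poly R}) f t : continuous f ->
  window h (\sum_i p i) f t = \sum_i window h (p i) f t.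
Proof.
move=> cf; elim: n => [|n IHn] in p *; first by rewrite !big_ord0 window0.
by rewrite !big_ord_recl window_polyD// IHn.
Qed.

Lemma is_derive_sumr n (F : 'I_n -> R -> R) (d : 'I_n -> R) t :
  (forall i, is_derive t 1 (F i) (d i)) ->
  is_derive t 1 (fun s => \sum_i F i s) (\sum_i d i).
Proof.
move=> dF; have -> : (fun s => \sum_i F i s) = \sum_i F i.
  by apply/funext => s; rewrite fct_sumE.
exact: is_derive_sum.
Qed.

(** Freezing each primitive at its value at [0] beyond its own half-line makes the sum continuous
    with no constants to match. *)
Lemma kink_primitive (r1 r2 : R -> R) : continuous r1 -> continuous r2 ->
  exists P : R -> R, [/\ continuous P, forall s : R, s < 0 -> is_derive s 1 P (r1 s) &
                              forall s : R, 0 < s -> is_derive s 1 P (r2 s)].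
Proof.
move=> /primitive_exists[P1 dP1] /primitive_exists[P2 dP2].
have cP1 : continuous P1 by move=> s; apply: is_derive_continuous (dP1 s).
have cP2 : continuous P2 by move=> s; apply: is_derive_continuous (dP2 s).
have c1 : continuous (fun s => P1 (Num.min s 0)).
  move=> s; apply: (@continuous_comp _ _ _ (fun s => Num.min s 0)); last exact: cP1.
  by apply: continuous_min => //; exact: cst_continuous.
have c2 : continuous (fun s => P2 (Num.max s 0)).
  move=> s; apply: (@continuous_comp _ _ _ (fun s => Num.max s 0)); last exact: cP2.
  by apply: continuous_max => //; exact: cst_continuous.
exists (fun s => P1 (Num.min s 0) + P2 (Num.max s 0)); split=> s.
- exact: continuousD (c1 s) (c2 s).
- move=> s0; have d : is_derive s 1 (fun s => P1 s + P2 0) (r1 s).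
    have := dP1 s => d1; have -> : (fun s => P1 s + P2 0) = P1 + cst (P2 0) by [].
    by apply: is_derive_eq; rewrite addr0.
  apply: near_eq_is_derive d; near=> y.
  have y0 : y < 0 by near: y; exact: lt_nbhsl.
  by rewrite min_l ?max_r ?ltW.
- move=> s0; have d : is_derive s 1 (fun s => P1 0 + P2 s) (r2 s).
    have := dP2 s => d1; have -> : (fun s => P1 0 + P2 s) = cst (P1 0) + P2 by [].
    by apply: is_derive_eq; rewrite add0r.
  apply: near_eq_is_derive d; near=> y.
  have y0 : 0 < y by near: y; exact: lt_nbhsr.
  by rewrite min_r ?max_l ?ltW.
Unshelve. all: by end_near. Qed.

(** Integration by parts across the jump: the weight [h + s] vanishes at the left end, which leaves
    only [h * P t] at the boundary. Absolute time [0] is the point [s = - t] of the window. *)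
Lemma kink_moment h r (r1 r2 : R -> R) P t : 0 <= h ->
    continuous r1 -> continuous r2 -> continuous P ->
    (forall s : R, s < 0 -> is_derive s 1 P (r1 s)) ->
    (forall s : R, 0 < s -> is_derive s 1 P (r2 s)) ->
    (forall s, t - h < s -> s < 0 -> r s = r1 s) ->
    (forall s, 0 < s -> r s = r2 s) ->
  \int[mu]_(s in `]- h, 0[) ((h + s) * r (t + s)) = h * P t - window h 1 P t.
Proof.
move=> h0 c1 c2 cP dP1 dP2 e1 e2.
have cPt := continuous_translate (t := t) cP.
have [Q dQ] := primitive_exists cPt.
have cQ : continuous Q by move=> s; apply: is_derive_continuous (dQ s).
have dF (d s : R) : is_derive (t + s) 1 P d ->
    is_derive s 1 (fun s => (h + s) * P (t + s) - Q s) ((h + s) * d).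
  move=> /is_derive_translate d1; have d2 := dQ s.
  have d3 := is_derive_horner_shift 'X h s.
  have -> : (fun s => (h + s) * P (t + s) - Q s) =
      (fun s => 'X.[h + s] * P (t + s) - Q s).
    by apply/funext => y; rewrite hornerX.
  by apply: is_derive_eq; rewrite derivX hornerC hornerX /GRing.scale /=; ring.
have cl : continuous (fun s : R => h + s).
  by move=> s; apply: continuousD => //; exact: cst_continuous.
rewrite (@piecewise_Rintegral _ _ (fun s => (h + s) * r1 (t + s))
  (fun s => (h + s) * r2 (t + s)) (fun s => (h + s) * P (t + s) - Q s) _ _ (- t)).
- rewrite !addr0 subrr mul0r sub0r opprK /window /moment.
  under eq_Rintegral do rewrite hornerC mul1r.
  by rewrite (@continuous_Rintegral _ _ Q) ?oppr_le0//; ring.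
- by rewrite oppr_le0.
- by apply: continuous_mul => //; exact: continuous_translate.
- by apply: continuous_mul => //; exact: continuous_translate.
- by move=> s; exact: (continuousB (continuous_mul cl cPt (x := s)) (cQ s)).
- move=> s /andP[hs _] st.
  have ts0 : t + s < 0 by rewrite addrC -ltrBrDr sub0r.
  by rewrite e1 ?ltrD2l//; split => //; apply/dF/dP1.
- move=> s /andP[hs _] st.
  have ts0 : 0 < t + s by rewrite addrC -ltrBlDr sub0r.
  by rewrite e2//; split => //; apply/dF/dP2.
Qed.

Lemma kink_derive_ge f F a b c : a <= b -> continuous F ->
  (forall s, a < s < b -> s != c -> is_derive s 1 F (f s)) ->
  (forall s, 0 <= f s) -> F a <= F b.
Proof.
move=> ab cF dF f0.
have mono (u v : R) : u <= v -> a <= u -> v <= b -> (c <= u) || (v <= c) -> F u <= F v.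
  move=> uv au vb uvc; suff : - F v <= - F u by rewrite lerN2.
  apply: (@derive_le _ (fun s => - F s) (fun s => - f s) u v) => //.
  - by move=> s; apply: continuousN; exact: cF.
  - move=> s /andP[us sv]; have sc : s != c.
      by case/orP: uvc => [/le_lt_trans/(_ us)/gt_eqF->|/(lt_le_trans sv)/lt_eqF->].
    have d := dF s _ sc; apply: is_deriveN; apply: d.
    by rewrite (le_lt_trans au)// (lt_le_trans sv).
  - by move=> s _; rewrite oppr_le0.
have [ca|ac] := leP c a; first by apply: mono; rewrite ?ca.
have [bc|cb] := leP b c; first by apply: mono; rewrite ?bc ?orbT.
by apply: (@le_trans _ _ (F c)); apply: mono; rewrite ?lexx ?orbT// ltW.
Qed.

End Window.

(** * Bilinear forms and Bessel's inequality *)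

Section Bilinear.
Context {R : realType}.
Implicit Types (P : R -> R) (h s t : R).

Definition bil d1 d2 (M : 'M[R]_(d1, d2)) (v : 'cV[R]_d1) (w : 'cV[R]_d2) : R :=
  (v^T *m M *m w) 0 0.

Lemma bilE d1 d2 (M : 'M[R]_(d1, d2)) v w :
  bil M v w = \sum_i \sum_j v j 0 * M j i * w i 0.
Proof.
rewrite /bil mxE; apply: eq_bigr => i _; rewrite mxE mulr_suml.
by apply: eq_bigr => j _; rewrite mxE.
Qed.

Lemma bil_suml d1 d2 (M : 'M[R]_(d1, d2)) n (v : 'I_n -> 'cV[R]_d1) w :
  bil M (\sum_k v k) w = \sum_k bil M (v k) w.
Proof. by rewrite /bil linear_sum !mulmx_suml summxE. Qed.

Lemma bil_sumr d1 d2 (M : 'M[R]_(d1, d2)) n v (w : 'I_n -> 'cV[R]_d2) :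
  bil M v (\sum_k w k) = \sum_k bil M v (w k).
Proof. by rewrite /bil mulmx_sumr summxE. Qed.

Lemma bilZl d1 d2 (M : 'M[R]_(d1, d2)) c v w : bil M (c *: v) w = c * bil M v w.
Proof. by rewrite /bil linearZ /= -!scalemxAl mxE. Qed.

Lemma bilZr d1 d2 (M : 'M[R]_(d1, d2)) c v w : bil M v (c *: w) = c * bil M v w.
Proof. by rewrite /bil -scalemxAr mxE. Qed.

Lemma bilDl d1 d2 (M : 'M[R]_(d1, d2)) v v' w :
  bil M (v + v') w = bil M v w + bil M v' w.
Proof. by rewrite /bil linearD /= !mulmxDl mxE. Qed.

Lemma bilDr d1 d2 (M : 'M[R]_(d1, d2)) v w w' :
  bil M v (w + w') = bil M v w + bil M v w'.
Proof. by rewrite /bil mulmxDr mxE. Qed.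

Lemma bil_tr d1 d2 (M : 'M[R]_(d1, d2)) v w : bil M v w = bil M^T w v.
Proof.
rewrite /bil; have -> : w^T *m M^T *m v = (v^T *m M *m w)^T.
  by rewrite !trmx_mul trmxK mulmxA.
by rewrite [RHS]mxE.
Qed.

Lemma bil_mxD d1 d2 (M N : 'M[R]_(d1, d2)) v w :
  bil (M + N) v w = bil M v w + bil N v w.
Proof. by rewrite /bil mulmxDr mulmxDl mxE. Qed.

Lemma bil_mxZ d1 d2 c (M : 'M[R]_(d1, d2)) v w : bil (c *: M) v w = c * bil M v w.
Proof. by rewrite /bil -scalemxAr -scalemxAl mxE. Qed.

Lemma bil_mxN d1 d2 (M : 'M[R]_(d1, d2)) v w : bil (- M) v w = - bil M v w.
Proof. by rewrite /bil mulmxN mulNmx mxE. Qed.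

Lemma bil_mx_sum d1 d2 n (M : 'I_n -> 'M[R]_(d1, d2)) v w :
  bil (\sum_k M k) v w = \sum_k bil (M k) v w.
Proof. by rewrite /bil mulmx_sumr mulmx_suml summxE. Qed.

Lemma bil_mulmx d1 d2 e1 e2 (L : 'M[R]_(e1, d1)) (M : 'M[R]_(e1, e2)) (N : 'M[R]_(e2, d2)) v w :
  bil (L^T *m M *m N) v w = bil M (L *m v) (N *m w).
Proof. by rewrite /bil trmx_mul !mulmxA. Qed.

(** Coordinatewise, like [is_derive_col], so that vector curves need only real-valued calculus. *)
Definition continuous_col (T : topologicalType) d (v : T -> 'cV[R]_d) :=
  forall a, continuous (fun z => v z a 0).

Definition is_derive_col d (t : R) (v : R -> 'cV[R]_d) (v' : 'cV[R]_d) :=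
  forall a, is_derive t 1 (fun s => v s a 0) (v' a 0).

Lemma continuous_bil (T : topologicalType) d1 d2 (M : 'M[R]_(d1, d2))
    (v : T -> 'cV[R]_d1) (w : T -> 'cV[R]_d2) :
  continuous_col v -> continuous_col w -> continuous (fun z => bil M (v z) (w z)).
Proof.
move=> cv cw; under eq_fun do rewrite bilE.
apply: continuous_sumr => i; apply: continuous_sumr => j.
apply: continuous_mul; last exact: cw.
by apply: continuous_mul; [exact: cv|move=> z; exact: cst_continuous].
Qed.

Lemma is_derive_bil d1 d2 (M : 'M[R]_(d1, d2)) t v w v' w' :
  is_derive_col t v v' -> is_derive_col t w w' ->
  is_derive t 1 (fun s => bil M (v s) (w s)) (bil M v' (w t) + bil M (v t) w').
Proof.
move=> dv dw; rewrite !bilE -big_split /=; under eq_fun do rewrite bilE.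
apply: is_derive_sumr => i; rewrite -big_split /=; apply: is_derive_sumr => j.
have d1' := dv j; have d2' := dw i.
have -> : (fun s => v s j 0 * M j i * w s i 0) =
          (fun s => M j i * (v s j 0 * w s i 0)).
  by apply/funext => s; rewrite mulrCA mulrA.
by apply: is_derive_eq; rewrite /GRing.scale /=; ring.
Qed.

Lemma continuous_col_cst (T : topologicalType) d (v : 'cV[R]_d) :
  continuous_col (fun _ : T => v).
Proof. by move=> a z; exact: cst_continuous. Qed.

Lemma is_derive_col_cst d t (v : 'cV[R]_d) : is_derive_col t (fun=> v) 0.
Proof. by move=> a; rewrite mxE; exact: is_derive_cst. Qed.

Lemma psd_bil_ge0 d (M : 'M[R]_d) v : psdmx M -> 0 <= bil M v v.
Proof. by move=> [_]; exact. Qed.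

Lemma psd_bilC d (M : 'M[R]_d) v w : psdmx M -> bil M v w = bil M w v.
Proof. by move=> [sM _]; rewrite bil_tr sM. Qed.

(* The k-th Legendre moment of the derivative of [x] on [t - h, t], after
   integration by parts. *)
Definition legendre_coef n h N k (x : R -> 'cV[R]_n) t : 'cV[R]_n :=
  x t + (-1) ^+ k.+1 *: x (t - h) +
  \sum_(j < N) gamma_coef R k j *:
    \col_a (h^-1 * window h (legendre h j) (fun s => x s a 0) t).

(** The right-hand side has the three terms of [is_derive_window]: [legendre_coef] is thus the time
    derivative of the [k]-th moment of [x]. The values [1] and [(-1) ^+ k] of [L_k] at the ends and
    the coefficients [gamma_coef] of its derivative give the equality. *)
Lemma legendre_coefE n h N k (x : R -> 'cV[R]_n) t : 0 < h -> (k <= N)%N ->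
    continuous_col x -> forall a,
  legendre_coef h N k x t a 0 = (legendre h k).[h] * x t a 0 -
    (legendre h k).[0] * x (t - h) a 0 -
    window h (legendre h k)^`() (fun s => x s a 0) t.
Proof.
move=> h0 kN cx a; have h0' := lt0r_neq0 h0.
rewrite (legendre_spec h0' k).1 legendre_horner0 (deriv_legendre_gamma h kN).
rewrite -[- (h^-1 *: _)]scaleNr window_polyZ; last exact: cx.
rewrite window_poly_sum; last exact: cx.
rewrite /legendre_coef !mxE summxE mul1r exprS mulN1r !mulNr opprK; congr (_ + _).
rewrite mulr_sumr; apply: eq_bigr => j _; rewrite !mxE window_polyZ; last exact: cx.
by rewrite mulrCA.
Qed.

(** The curve [h^-1 *: v], with [v] the sum of the [(2k + 1) L_k Omega_k], is the Legendre
    projection of [x']. A continuous [E] whose derivative is the form [M] at [x' - h^-1 *: v] is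
    nondecreasing, and its increment is the difference of the two sides divided by [h]. *)
Lemma bessel_legendre n (M : 'M[R]_n) N h t (x y1 y2 : R -> 'cV[R]_n) P :
    psdmx M -> 0 < h -> continuous_col x ->
    (forall s, t - h < s -> s < 0 -> is_derive_col s x (y1 s)) ->
    (forall s, t - h < s -> 0 < s -> is_derive_col s x (y2 s)) ->
    continuous P ->
    (forall s, s < 0 -> is_derive s 1 P (bil M (y1 s) (y1 s))) ->
    (forall s, 0 < s -> is_derive s 1 P (bil M (y2 s) (y2 s))) ->
  \sum_(k < N.+1) (2 * k + 1)%:R *
    bil M (legendre_coef h N k x t) (legendre_coef h N k x t) <= h * (P t - P (t - h)).
Proof.
move=> psdM h0 cx dx1 dx2 cP dP1 dP2; pose Omega k := legendre_coef h N k x t.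
have h0' := lt0r_neq0 h0.
pose L := legendre h; pose c (k : nat) : R := (2 * k + 1)%:R.
pose f (k : 'I_N.+1) s := bil M (Omega k) (x s).
have cf k : continuous (f k) by apply: continuous_bil => //; exact: continuous_col_cst.
have cfL (k : 'I_N.+1) : continuous (fun s => (L k)^`().[h + s] * f k (t + s)).
  by apply: continuous_mul; [exact: continuous_horner_shift|exact: (@continuous_translate _ (f k))].
(* Subtracting [Z k] cancels the term in [L_k']: the derivative of [L_k f_k - Z_k] is [L_k] times
   the pairing of [Omega k] with [x']. *)
have /choice[Z dZ] := fun k => primitive_exists (cfL k).
have cZ k : continuous (Z k) by move=> s; apply: is_derive_continuous (dZ k s).
have fO (k : 'I_N.+1) : (L k).[h] * f k t - (L k).[0] * f k (t - h) -
    window h (L k)^`() (f k) t = bil M (Omega k) (Omega k).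
  have fE : f k = fun s => \sum_i (\sum_j Omega k j 0 * M j i) * x s i 0.
    by apply/funext => s; rewrite /f bilE; apply: eq_bigr => i _; rewrite mulr_suml.
  rewrite fE window_sum; last first.
    by move=> i; apply: continuous_mul; [move=> s; exact: cst_continuous|exact: cx].
  rewrite !mulr_sumr -!sumrB bilE; apply: eq_bigr => i _.
  rewrite -mulr_suml windowZ; last exact: cx.
  have kN : (k <= N)%N by rewrite -ltnS.
  rewrite {2}/Omega (legendre_coefE t h0 kN cx).
  by ring.
(* The three terms are primitives of the square of [x'], of the cross term and of the square of
   [h^-1 *: v], all taken in the form [M]. *)
pose E s := P (t + s)
  - 2 / h * (\sum_(k < N.+1) c k * ((L k).[h + s] * f k (t + s) - Z k s))
  + h^-1 ^+ 2 * \sum_(k < N.+1) \sum_(l < N.+1)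
      c k * c l * bil M (Omega k) (Omega l) * (primp (L k * L l)).[h + s].
pose v s : 'cV[R]_n := \sum_(k < N.+1) (c k * (L k).[h + s]) *: Omega k.
have key (y : R -> 'cV[R]_n) s : is_derive_col (t + s) x (y (t + s)) ->
    is_derive (t + s) 1 P (bil M (y (t + s)) (y (t + s))) ->
    is_derive s 1 E (bil M (y (t + s) - h^-1 *: v s) (y (t + s) - h^-1 *: v s)).
  move=> dx /is_derive_translate dP.
  have d2 : is_derive s 1 (fun s => \sum_(k < N.+1)
      c k * ((L k).[h + s] * f k (t + s) - Z k s))
      (bil M (v s) (y (t + s))).
    rewrite bil_suml; apply: is_derive_sumr => k; rewrite bilZl.
    have e1 := is_derive_horner_shift (L k) h s; have e2 := dZ k s.
    have e3 : is_derive s 1 (fun s => f k (t + s)) (bil M (Omega k) (y (t + s))).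
      apply: (@is_derive_translate _ (f k)).
      have := is_derive_bil M (is_derive_col_cst (t + s) (Omega k)) dx.
      by rewrite -[0](scale0r 0) bilZl mul0r add0r.
    by apply: is_derive_eq; rewrite /GRing.scale /=; ring.
  have d3 : is_derive s 1 (fun s => \sum_(k < N.+1) \sum_(l < N.+1)
      c k * c l * bil M (Omega k) (Omega l) * (primp (L k * L l)).[h + s])
      (bil M (v s) (v s)).
    rewrite bil_suml; apply: is_derive_sumr => k.
    rewrite bilZl bil_sumr mulr_sumr; apply: is_derive_sumr => l; rewrite bilZr.
    have e1 := is_derive_horner_shift (primp (L k * L l)) h s.
    by apply: is_derive_eq; rewrite deriv_primp hornerM /GRing.scale /=; ring.
  apply: is_derive_eq.
  have -> : y (t + s) - h^-1 *: v s = y (t + s) + (- h^-1) *: v s by rewrite scaleNr.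
  rewrite !(bilDl, bilDr) !(bilZl, bilZr).
  rewrite (psd_bilC (y _) (v s) psdM).
  by rewrite /GRing.scale /=; field.
have cE : continuous E.
  have cP' := continuous_translate (t := t) cP.
  have cS1 : continuous (fun s => \sum_(k < N.+1)
      c k * ((L k).[h + s] * f k (t + s) - Z k s)).
    apply: continuous_sumr => k; apply: continuous_mul.
      by move=> s; exact: cst_continuous.
    have cf' := continuous_translate (t := t) (cf k).
    have cLf := continuous_mul (continuous_horner_shift (p := L k) (h := h)) cf'.
    by move=> s; exact: continuousB (cLf s) (cZ k s).
  have cS2 : continuous (fun s => \sum_(k < N.+1) \sum_(l < N.+1)
      c k * c l * bil M (Omega k) (Omega l) * (primp (L k * L l)).[h + s]).
    apply: continuous_sumr => k; apply: continuous_sumr => l; apply: continuous_mul.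
      by move=> s; exact: cst_continuous.
    exact: continuous_horner_shift.
  have cc (d : R) : continuous (fun _ : R => d) by move=> s; exact: cst_continuous.
  have c1 := continuous_mul (cc (2 / h)) cS1.
  have c2 := continuous_mul (cc (h^-1 ^+ 2)) cS2.
  by move=> s; exact: continuousD (continuousB (cP' s) (c1 s)) (c2 s).
have incE : E (- h) <= E 0.
  pose y s := if s < 0 then y1 s else y2 s.
  apply: (@kink_derive_ge _ (fun s => bil M (y (t + s) - h^-1 *: v s)
    (y (t + s) - h^-1 *: v s)) E _ _ (- t)) => //; first by rewrite oppr_le0 ltW.
    move=> s /andP[hs _] st.
    have hts : t - h < t + s by rewrite ltrD2l.
    have : t + s != 0 by rewrite addrC addr_eq0.
    rewrite neq_lt => /orP[ts|ts]; apply: key; rewrite /y ?ts ?ltNge ?(ltW ts) /=;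
      by [exact: dx1|exact: dP1|exact: dx2|exact: dP2].
  by move=> s; exact: psd_bil_ge0.
(* Over the window the cross sum grows by [S], by integration by parts, and the double sum by
   [h * S], by orthogonality; [- 2 / h * S + h^-1 ^+ 2 * (h * S)] is [- S / h]. *)
pose S := \sum_(k < N.+1) c k * bil M (Omega k) (Omega k).
have S1 : \sum_(k < N.+1) c k * ((L k).[h] * f k t - Z k 0) -
    \sum_(k < N.+1) c k * ((L k).[0] * f k (t - h) - Z k (- h)) = S.
  rewrite -sumrB; apply: eq_bigr => k _; rewrite -mulrBr -fO /window /moment.
  rewrite (@continuous_Rintegral _ _ (Z k)) ?oppr_le0 ?ltW//.
  by congr (_ * _); ring.
have S2 : \sum_(k < N.+1) \sum_(l < N.+1)
    c k * c l * bil M (Omega k) (Omega l) * (primp (L k * L l)).[h] = h * S.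
  rewrite mulr_sumr; apply: eq_bigr => k _.
  rewrite (bigD1 k)//= big1 => [|l lk].
    rewrite -[(primp _).[h]]/(intp h _) legendre_orthogonal// eqxx addr0 -/(c k).
    have ck : c k != 0 by rewrite pnatr_eq0 addn1.
    by field.
  rewrite -[(primp _).[h]]/(intp h _) legendre_orthogonal// ifN ?mulr0//.
  by rewrite eq_sym.
have S3 : \sum_(k < N.+1) \sum_(l < N.+1)
    c k * c l * bil M (Omega k) (Omega l) * (primp (L k * L l)).[0] = 0.
  by rewrite big1// => k _; rewrite big1// => l _; rewrite primp_horner0 mulr0.
have dE : E 0 - E (- h) = P t - P (t - h) - h^-1 * S.
  rewrite /E !addr0 addrN S2 S3 -S1.
  by field.
by move: incE; rewrite -subr_ge0 dE subr_ge0 ler_pdivrMl.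
Qed.

End Bilinear.

(** * The block matrices of the matrix inequality *)

Section BlockAlgebra.
Context {R : realType} (q n m N : nat).
Implicit Types (x : 'cV[R]_n) (xd : 'I_q -> 'cV[R]_n)
  (om : 'I_q -> nat -> 'cV[R]_n) (u : 'cV[R]_m).

Definition zeta x xd om u : 'cV[R]_(zeta_dim q N n m) :=
  col4_mx x (\mxcol_i xd i) (\mxcol_(i < q) \mxcol_(k < N) om i k) u.

Lemma row4_mulE r n1 n2 n3 n4 (X1 : 'M[R]_(r, n1)) (X2 : 'M[R]_(r, n2))
    (X3 : 'M[R]_(r, n3)) (X4 : 'M[R]_(r, n4)) v1 v2 v3 (v4 : 'cV[R]_n4) :
  row4_mx X1 X2 X3 X4 *m col4_mx v1 v2 v3 v4 =
  X1 *m v1 + (X2 *m v2 + (X3 *m v3 + X4 *m v4)).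
Proof. by rewrite /row4_mx /col4_mx !mul_row_col. Qed.

Lemma F_mx_zeta A Ad B x xd om u :
  F_mx N A Ad B *m zeta x xd om u = A *m x + \sum_i Ad i *m xd i + B *m u.
Proof. by rewrite row4_mulE mul_mxrow_mxcol mul0mx add0r addrA. Qed.

Lemma Gamma_row_zeta i k x xd om u :
  Gamma_row R n m N i k *m zeta x xd om u =
  x + (-1) ^+ k.+1 *: xd i + \sum_(j < N) gamma_coef R k j *: om i j.
Proof.
rewrite row4_mulE !mul_mxrow_mxcol mul1mx mul0mx addr0 addrA; congr (_ + _ + _).
  rewrite (bigD1 i)//= eqxx mul_scalar_mx big1 ?addr0// => j /negbTE->.
  by rewrite mul0mx.
rewrite (bigD1 i)//= mul_mxrow_mxcol [X in _ + X]big1 ?addr0 => [|j /negbTE ji].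
  by apply: eq_bigr => j _; rewrite eqxx mul_scalar_mx.
by rewrite mul_mxrow_mxcol big1// => l _; rewrite ji mul0mx.
Qed.

Lemma G_mx_zeta tau x xd om u :
  G_mx n m N tau *m zeta x xd om u =
  col_mx x (\mxcol_(i < q) \mxcol_(k < N) (tau i *: om i k)).
Proof.
rewrite mul_col_mx !row4_mulE !mul0mx mul1mx !addr0 !add0r; congr col_mx.
rewrite mul_mxdiag_mxcol; apply: eq_mxcol => i; rewrite mul_scalar_mx.
by apply/colP => a; rewrite !mxE.
Qed.

Lemma H_mx_zeta A Ad B x xd om u :
  H_mx N A Ad B *m zeta x xd om u =
  col_mx (F_mx N A Ad B *m zeta x xd om u)
    (\mxcol_(i < q) \mxcol_(k < N) (Gamma_row R n m N i k *m zeta x xd om u)).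
Proof.
rewrite mul_col_mx; congr col_mx.
by rewrite mxcol_mul; apply: eq_mxcol => i; rewrite mxcol_mul.
Qed.

Lemma bil_mxdiag k (p_ : 'I_k -> nat) (M : forall i, 'M[R]_(p_ i))
    (v w : forall i, 'cV[R]_(p_ i)) :
  bil (\mxdiag_i M i) (\mxcol_i v i) (\mxcol_i w i) = \sum_i bil (M i) (v i) (w i).
Proof.
rewrite /bil -mulmxA mul_mxdiag_mxcol tr_mxcol mul_mxrow_mxcol summxE.
by apply: eq_bigr => i _; rewrite mulmxA.
Qed.

Lemma bil_Gamma_zeta Rm x xd om u : let z := zeta x xd om u in
  bil ((Gamma_mx R q n m N)^T *m Rdiag_mx N Rm *m Gamma_mx R q n m N) z z =
  \sum_i \sum_(k < N.+1) (2 * k + 1)%:R *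
    bil (Rm i) (Gamma_row R n m N i k *m z) (Gamma_row R n m N i k *m z).
Proof.
move=> z; rewrite bil_mulmx /Gamma_mx mxcol_mul.
rewrite bil_mxdiag; apply: eq_bigr => i _.
by rewrite mxcol_mul bil_mxdiag; apply: eq_bigr => k _; rewrite bil_mxZ.
Qed.

Lemma bil_M0_zeta Theta C S11 S12 S22 x xd om u :
  let z := zeta x xd om u in
  bil (M0_mx N Theta C S11 S12 S22) z z =
  \sum_i (bil (Theta i) x x - bil (Theta i) (xd i) (xd i)) -
    quadratic_supply S11 S12 S22 (C *m x) u.
Proof.
move=> z; rewrite /bil -mulmxA.
have -> : M0_mx N Theta C S11 S12 S22 *m z = col4_mx
    ((\sum_i Theta i - C^T *m S11 *m C) *m x - C^T *m S12 *m u)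
    (\mxcol_i (- (Theta i *m xd i))) 0 (- (S12^T *m C) *m x - S22 *m u).
  rewrite /M0_mx {1}/col4_mx !mul_col_mx !row4_mulE !mul0mx !add0r !addr0.
  by rewrite !mulNmx mul_mxdiag_mxcol -mxcolN.
rewrite /z /zeta /col4_mx !tr_col_mx !mul_row_col tr_mxcol mul_mxrow_mxcol mulmx0 add0r.
rewrite /quadratic_supply tr_col_mx mul_row_block mul_row_col.
rewrite !(mulmxDl, mulmxDr, mulmxN, mulNmx) trmx_mul !mulmxA.
rewrite sumrB.
have -> : \sum_i (xd i)^T *m - (Theta i *m xd i) =
    - \sum_i ((xd i)^T *m Theta i *m xd i).
  by rewrite -sumrN; apply: eq_bigr => i _; rewrite mulmxN mulmxA.
rewrite mulmx_sumr mulmx_suml -!summxE.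
move: (\sum_i _) (\sum_i _) (_ *m C *m x) (_ *m C *m x) (_ *m u) (_ *m u).
by move=> a b c d e f; rewrite !mxE; ring.
Qed.

Lemma bil_M1_zeta tau A Ad B Rm x xd om u : let z := zeta x xd om u in
  bil (M1_mx N tau A Ad B Rm) z z = \sum_i tau i ^+ 2 *
    bil (Rm i) (F_mx N A Ad B *m z) (F_mx N A Ad B *m z).
Proof.
by move=> z; rewrite bil_mulmx bil_mx_sum; apply: eq_bigr => i _; rewrite bil_mxZ.
Qed.

Lemma bil_symmx d (M : 'M[R]_d) v : bil (2 *: symmx M) v v = 2 * bil M v v.
Proof.
rewrite scalerA divff ?pnatr_eq0// scale1r bil_mxD -bil_tr.
by rewrite mulr_natl mulr2n.
Qed.

End BlockAlgebra.

(** * Curves in R^n *)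

Section Curves.
Context {R : realType}.
Implicit Types (h s t : R).

(** Used with clamping maps to extend the solution, the derivative of the history and the input
    continuously to the whole line. *)
Lemma continuous_retract (T : topologicalType) (A : set R) (c : R -> R) (g : R -> T) :
  continuous c -> (forall s, A (c s)) -> {within A, continuous g} ->
  continuous (fun s => g (c s)).
Proof.
move=> cc Ac /subspace_continuousP cg s.
apply: (@cvg_comp _ _ _ c g _ (within A (nbhs (c s)))); last exact: cg.
move=> P /= wP; have wc : nbhs s (c @^-1` [set y | A y -> P y]) := cc s _ wP.
change (nbhs s (c @^-1` P)).
by apply: filterS wc => y H; exact: H (Ac y).
Qed.

Lemma continuous_coord (T : topologicalType) d (f : T -> 'cV[R]_d) :
  continuous f -> continuous_col f.
Proof.
move=> cf a s; apply: (@continuous_comp _ _ _ f (fun v : 'cV[R]_d => v a 0)).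
  exact: cf.
exact: coord_continuous.
Qed.

Lemma is_derive_in_col d (D : set R) (f : R -> 'cV[R]_d) t l :
  nbhs t D -> is_derive_in D f t l -> is_derive_col t f l.
Proof.
move=> nD df a.
have : (s - t)^-1 * (f s a 0 - f t a 0) @[s --> t^'] --> l a 0.
  have : ((s - t)^-1 *: (f s - f t)) a 0 @[s --> within D t^'] --> l a 0.
    apply: (@cvg_comp _ _ _ (fun s => (s - t)^-1 *: (f s - f t))
      (fun v : 'cV[R]_d => v a 0) _ (nbhs l)); first exact: df.
    exact: coord_continuous.
  move=> H P /H; rewrite /nbhs /= /within /= => HP.
  have : t^' D by exact: nbhs_dnbhs.
  move: HP; apply: filterS2 => s /[apply].
  by rewrite !mxE.
move=> /cvgrPdist_lt cvl.
have lim : h^-1 *: (f (h *: 1 + t) a 0 - f t a 0) @[h --> 0^'] --> l a 0.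
  apply/cvgrPdist_lt => e /cvl [r /= r0 H].
  exists r => //= y; rewrite /ball_ /= => yr y0.
  have := H (y + t); rewrite /= addrK; rewrite [y *: 1]mulr1; apply.
    by rewrite opprD addrCA subrr addr0 -[- y]sub0r.
  by rewrite -subr_eq0 addrK.
apply: DeriveDef; last exact/cvg_lim/lim.
by apply/cvg_ex; exists (l a 0).
Qed.

Lemma near_eq_is_derive_col d (f g : R -> 'cV[R]_d) t l :
  (\near t, f t = g t) -> is_derive_col t f l -> is_derive_col t g l.
Proof.
move=> fg df a; apply: near_eq_is_derive (df a).
by apply: filterS fg => s ->.
Qed.

(** Built on the total operator [derive1], so that [storage] is defined on every curve; where no
    derivative exists the value is a default. *)
Definition deriv_col d (f : R -> 'cV[R]_d) s : 'cV[R]_d :=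
  \col_a derive1 (fun r => f r a 0) s.

Lemma deriv_colE d (f : R -> 'cV[R]_d) t l :
  is_derive_col t f l -> deriv_col f t = l.
Proof. by move=> df; apply/colP => a; rewrite mxE derive1E; have [] := df a. Qed.

Lemma deriv_col_translate d (f : R -> 'cV[R]_d) t s :
  deriv_col (fun r => f (t + r)) s = deriv_col f (t + s).
Proof.
apply/colP => a; rewrite !mxE /derive1.
have -> : (fun y => y^-1 *: (f (t + (y + s)) a 0 - f (t + s) a 0)) =
          (fun y => y^-1 *: (f (y + (t + s)) a 0 - f (t + s) a 0)).
  by apply/funext => y; rewrite addrCA.
by [].
Qed.

Lemma eq_deriv_col d (f g : R -> 'cV[R]_d) t :
  (\near t, f t = g t) -> deriv_col f t = deriv_col g t.
Proof.
move=> fg; apply/colP => a; rewrite !mxE !derive1E.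
by apply: near_eq_derive; apply: filterS fg => s ->.
Qed.

Lemma deriv_col_cst d (v : 'cV[R]_d) t : deriv_col (fun=> v) t = 0.
Proof. exact/deriv_colE/is_derive_col_cst. Qed.

End Curves.

(** * The storage functional *)

Section Storage.
Context {R : realType} (q n N : nat).
Notation mu := (@lebesgue_measure R).
Variables (tau : 'I_q -> R) (Theta Rm : 'I_q -> 'M[R]_n)
  (P : 'M[R]_(n + omega_dim q N n)).
Implicit Types (f g : R -> 'cV[R]_n) (s t : R).

(* The vector (f(0), tau_i omega^i_k) on which [P] acts. *)
Definition storage_state f : 'cV[R]_(n + omega_dim q N n) :=
  col_mx (f 0) (\mxcol_(i < q) \mxcol_(k < N)
    \col_a moment (tau i) (legendre (tau i) k) (fun s => f s a 0)).

(** The last integral runs over an open interval because the two-sided derivative at an endpoint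
    would depend on values of [f] outside the window. *)
Definition storage f : R :=
  bil P (storage_state f) (storage_state f) +
  \sum_i \int[mu]_(s in `[- tau i, 0]) bil (Theta i) (f s) (f s) +
  \sum_i tau i * \int[mu]_(s in `]- tau i, 0[)
    ((tau i + s) * bil (Rm i) (deriv_col f s) (deriv_col f s)).

Lemma bil0l d1 d2 (M : 'M[R]_(d1, d2)) w : bil M 0 w = 0.
Proof. by rewrite -[0](scale0r 0) bilZl mul0r. Qed.

Lemma storage_is_functional h : 0 <= h -> (forall i, 0 < tau i <= h) ->
  psdmx P -> (forall i, psdmx (Theta i)) -> (forall i, psdmx (Rm i)) ->
  storage_functional h storage.
Proof.
move=> h0 tauh psdP psdT psdR.
have sub (i : 'I_q) s : s \in `[- tau i, 0] -> s \in `[- h, 0].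
  rewrite !in_itv /= => /andP[ts ->]; rewrite andbT (le_trans _ ts)// lerN2.
  by case/andP: (tauh i).
split.
- move=> f _; rewrite !addr_ge0 ?psd_bil_ge0//; apply: sumr_ge0 => i _.
    by apply: Rintegral_ge0 => s _; exact: psd_bil_ge0.
  have /andP[t0 _] := tauh i; rewrite mulr_ge0 ?(ltW t0)//.
  apply: Rintegral_ge0 => s /=; rewrite in_itv /= => /andP[ts _].
  by rewrite mulr_ge0 ?psd_bil_ge0// -lerBlDl sub0r ltW.
- have zero (D : set R) (F : R -> R) : (forall s, F s = 0) -> \int[mu]_(s in D) F s = 0.
    by move=> F0; under eq_Rintegral do rewrite F0; rewrite /Rintegral integral0.
  have st0 : storage_state (fun=> 0) = 0.
    rewrite /storage_state -col_mx0; congr col_mx; apply/colP => a; rewrite !mxE.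
    by rewrite /moment zero// => s; rewrite mulr0.
  rewrite /storage st0 bil0l add0r !big1 ?addr0// => i _.
    by rewrite zero ?mulr0// => s; rewrite deriv_col_cst bil0l mulr0.
  by rewrite zero// => s; rewrite bil0l.
- move=> f g _ _ fg; rewrite /storage.
  have st : storage_state f = storage_state g.
    rewrite /storage_state fg ?in_itv /= ?oppr_le0 ?h0 ?lexx//; congr col_mx.
    apply/eq_mxcol => i; apply/eq_mxcol => k; apply/colP => a; rewrite !mxE.
    by apply: eq_moment => s /sub hs; rewrite fg.
  have ei (i : 'I_q) : \int[mu]_(s in `[- tau i, 0]) bil (Theta i) (f s) (f s) =
      \int[mu]_(s in `[- tau i, 0]) bil (Theta i) (g s) (g s).
    by apply: eq_Rintegral => s; rewrite inE /= => /sub hs; rewrite fg.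
  (* At an interior point of the window the two curves agree on a whole neighbourhood, hence have
     the same derivative. *)
  have ed (i : 'I_q) :
      \int[mu]_(s in `]- tau i, 0[)
        ((tau i + s) * bil (Rm i) (deriv_col f s) (deriv_col f s)) =
      \int[mu]_(s in `]- tau i, 0[)
        ((tau i + s) * bil (Rm i) (deriv_col g s) (deriv_col g s)).
    apply: eq_Rintegral => s; rewrite inE /= in_itv /= => /andP[ts s0].
    rewrite (@eq_deriv_col _ _ f g)//; near=> y; apply: fg; apply: (sub i).
    rewrite in_itv /= !ltW//; near: y; by [exact: lt_nbhsl|exact: lt_nbhsr].
  rewrite st (eq_bigr _ (fun i _ => ei i)).
  by under [X in _ + X = _]eq_bigr do rewrite ed.
Unshelve. all: by end_near. Qed.

End Storage.

(** * Continuity of the supply rate *)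

Section QuadraticSupply.
Context {R : realType} (m : nat) (S11 S12 S22 : 'M[R]_m).

Lemma continuous_quadratic_supply_col (T : topologicalType) (y u : T -> 'cV[R]_m) :
  continuous_col y -> continuous_col u ->
  continuous (fun z => quadratic_supply S11 S12 S22 (y z) (u z)).
Proof.
move=> cy cu; apply: continuous_bil => a; under eq_fun do rewrite mxE;
  by case: splitP => j _; [exact: cy|exact: cu].
Qed.

Lemma continuous_quadratic_supply :
  continuous (fun yu : 'cV[R]_m * 'cV[R]_m => quadratic_supply S11 S12 S22 yu.1 yu.2).
Proof.
apply: continuous_quadratic_supply_col; apply: continuous_coord => z.
  exact: cvg_fst.
exact: cvg_snd.
Qed.

End QuadraticSupply.

(** * Dissipation along a trajectory *)

Section Trajectory.
Context {R : realType} (q n m N : nat).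
Notation mu := (@lebesgue_measure R).
Variables (tau : 'I_q -> R) (Theta Rm : 'I_q -> 'M[R]_n)
  (P : 'M[R]_(n + omega_dim q N n)) (A : 'M[R]_n) (Ad : 'I_q -> 'M[R]_n)
  (B : 'M[R]_(n, m)) (C : 'M[R]_(m, n)) (S11 S12 S22 : 'M[R]_m) (h : R).
Hypothesis h0 : 0 <= h.
Hypothesis tauh : forall i, 0 < tau i <= h.
Hypotheses (psdP : psdmx P) (psdR : forall i, psdmx (Rm i)).
Hypothesis LMI :
  nsdmx (2 *: symmx ((G_mx n m N tau)^T *m P *m H_mx N A Ad B)
         + M0_mx N Theta C S11 S12 S22
         + M1_mx N tau A Ad B Rm
         - (Gamma_mx R q n m N)^T *m Rdiag_mx N Rm *m Gamma_mx R q n m N).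
Implicit Types (s t : R).
(** [X] and [U] stand for a solution and an input extended continuously to the whole line, [y] for
    an extension of the derivative of the history. No derivative of [X] is prescribed at time
    [0]. *)
Variables (X y : R -> 'cV[R]_n) (U : R -> 'cV[R]_m).
Hypotheses (cX : continuous_col X) (cy : continuous_col y) (cU : continuous_col U).

Definition rhs t : 'cV[R]_n := A *m X t + \sum_i Ad i *m X (t - tau i) + B *m U t.

Hypothesis dX1 : forall s, - h < s -> s < 0 -> is_derive_col s X (y s).
Hypothesis dX2 : forall s, 0 < s -> is_derive_col s X (rhs s).

Let tau0 i : 0 < tau i. Proof. by case/andP: (tauh i). Qed.

Lemma continuous_mulmx d e (M : 'M[R]_(d, e)) (v : R -> 'cV[R]_e) :
  continuous_col v -> continuous_col (fun s => M *m v s).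
Proof.
move=> cv a; under eq_fun do rewrite mxE.
apply: continuous_sumr => i; apply: continuous_mul; last exact: cv.
by move=> s; exact: cst_continuous.
Qed.

Lemma continuous_delay t : continuous_col (fun s => X (s - t)).
Proof.
by move=> a; under eq_fun do rewrite addrC; exact: (@continuous_translate _ (fun s => X s a 0)).
Qed.

Lemma continuous_rhs : continuous_col rhs.
Proof.
move=> a; have -> : (fun s => rhs s a 0) = (fun s => (A *m X s) a 0 +
    \sum_i (Ad i *m X (s - tau i)) a 0 + (B *m U s) a 0).
  by apply/funext => s; rewrite [LHS]mxE; congr (_ + _); rewrite [LHS]mxE summxE.
have c1 := @continuous_mulmx _ _ A _ cX a; have c3 := @continuous_mulmx _ _ B _ cU a.
have c2 : continuous (fun s => \sum_i (Ad i *m X (s - tau i)) a 0).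
  apply: continuous_sumr => i.
  exact: (@continuous_mulmx _ _ (Ad i) _ (@continuous_delay (tau i)) a).
by move=> s; exact: continuousD (continuousD (c1 s) (c2 s)) (c3 s).
Qed.

Definition omega t i k : 'cV[R]_n :=
  \col_a ((tau i)^-1 * window (tau i) (legendre (tau i) k) (fun s => X s a 0) t).

Definition zeta_at t := zeta N (X t) (fun i => X (t - tau i)) (omega t) (U t).

Definition state_at t : 'cV[R]_(n + omega_dim q N n) :=
  col_mx (X t) (\mxcol_(i < q) \mxcol_(k < N)
    \col_a window (tau i) (legendre (tau i) k) (fun s => X s a 0) t).

Lemma G_zeta_at t : G_mx n m N tau *m zeta_at t = state_at t.
Proof.
rewrite G_mx_zeta; congr col_mx; apply/eq_mxcol => i; apply/eq_mxcol => k.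
by apply/colP => a; rewrite !mxE mulVKf// lt0r_neq0.
Qed.

Lemma F_zeta_at t : F_mx N A Ad B *m zeta_at t = rhs t.
Proof. exact: F_mx_zeta. Qed.

Lemma Gamma_zeta_at i k t :
  Gamma_row R n m N i k *m zeta_at t = legendre_coef (tau i) N k X t.
Proof. exact: Gamma_row_zeta. Qed.

Lemma is_derive_col_mx d e t (v : R -> 'cV[R]_d) (w : R -> 'cV[R]_e) v' w' :
  is_derive_col t v v' -> is_derive_col t w w' ->
  is_derive_col t (fun s => col_mx (v s) (w s)) (col_mx v' w').
Proof.
move=> dv dw a; rewrite mxE; under eq_fun do rewrite mxE.
by case: splitP => j _; [exact: dv|exact: dw].
Qed.

Lemma is_derive_mxcol k (p_ : 'I_k -> nat) t (v : forall i, R -> 'cV[R]_(p_ i)) v' :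
  (forall i, is_derive_col t (v i) (v' i)) ->
  is_derive_col t (fun s => \mxcol_i v i s) (\mxcol_i v' i).
Proof.
by move=> dv a; rewrite mxE; under eq_fun do rewrite mxE; exact: dv.
Qed.

Lemma continuous_col_mx d e (v : R -> 'cV[R]_d) (w : R -> 'cV[R]_e) :
  continuous_col v -> continuous_col w -> continuous_col (fun s => col_mx (v s) (w s)).
Proof.
move=> cv cw a; under eq_fun do rewrite mxE.
by case: splitP => j _; [exact: cv|exact: cw].
Qed.

Lemma continuous_mxcol k (p_ : 'I_k -> nat) (v : forall i, R -> 'cV[R]_(p_ i)) :
  (forall i, continuous_col (v i)) -> continuous_col (fun s => \mxcol_i v i s).
Proof. by move=> cv a; under eq_fun do rewrite mxE; exact: cv. Qed.

Lemma continuous_state : continuous_col state_at.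
Proof.
apply: continuous_col_mx => //; apply: continuous_mxcol => i.
apply: continuous_mxcol => k a; under eq_fun do rewrite mxE.
exact: continuous_window (ltW (tau0 i)) (@cX a).
Qed.

(** [is_derive_window] and [legendre_coefE] have the same right-hand side. The state uses the
    moments [k < N] only, while Bessel's inequality also uses [k = N]. *)
Lemma is_derive_state t : 0 < t ->
  is_derive_col t state_at (H_mx N A Ad B *m zeta_at t).
Proof.
move=> t0; rewrite H_mx_zeta F_zeta_at; apply: is_derive_col_mx; first exact: dX2.
apply: is_derive_mxcol => i; apply: is_derive_mxcol => k a.
under eq_fun do rewrite mxE.
rewrite Gamma_zeta_at (legendre_coefE t (tau0 i) (ltnW (ltn_ord k)) cX).
exact: is_derive_window (ltW (tau0 i)) (@cX a).
Qed.

Let rho i s := bil (Rm i) (rhs s) (rhs s).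

(* [Pi i] is not differentiable at the origin, where the derivative of [X] jumps. *)
Definition energy_primitive (Pi : 'I_q -> R -> R) := forall i,
  [/\ continuous (Pi i),
      forall s, s < 0 -> is_derive s 1 (Pi i) (bil (Rm i) (y s) (y s)) &
      forall s, 0 < s -> is_derive s 1 (Pi i) (bil (Rm i) (rhs s) (rhs s))].

Lemma energy_primitive_exists : exists Pi, energy_primitive Pi.
Proof.
suff /choice[Pi ePi] : forall i, exists Q : R -> R, [/\ continuous Q,
      forall s, s < 0 -> is_derive s 1 Q (bil (Rm i) (y s) (y s)) &
      forall s, 0 < s -> is_derive s 1 Q (bil (Rm i) (rhs s) (rhs s))].
  by exists Pi.
move=> i; apply: (@kink_primitive _ (fun s => bil (Rm i) (y s) (y s))
  (fun s => bil (Rm i) (rhs s) (rhs s))).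
  exact: continuous_bil.
by apply: continuous_bil; exact: continuous_rhs.
Qed.

(** The storage functional along the trajectory after integration by parts of the energy term. A
    constant added to [Pi i] cancels in the last sum. *)
Definition storage_at Pi t : R :=
  bil P (state_at t) (state_at t) +
  \sum_i window (tau i) 1 (fun s => bil (Theta i) (X s) (X s)) t +
  \sum_i tau i * (tau i * Pi i t - window (tau i) 1 (Pi i) t).

(** The equation on [v] lets [zeta_at s] stay folded when the lemma is applied, in the form that
    [G_zeta_at] and [F_zeta_at] rewrite. *)
Lemma LMI_zeta x xd om u v : v = zeta N x xd om u ->
  2 * bil P (G_mx n m N tau *m v) (H_mx N A Ad B *m v) +
  (\sum_i (bil (Theta i) x x - bil (Theta i) (xd i) (xd i)) -
    quadratic_supply S11 S12 S22 (C *m x) u) +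
  \sum_i tau i ^+ 2 * bil (Rm i) (F_mx N A Ad B *m v) (F_mx N A Ad B *m v) <=
  \sum_i \sum_(k < N.+1) (2 * k + 1)%:R *
    bil (Rm i) (Gamma_row R n m N i k *m v) (Gamma_row R n m N i k *m v).
Proof.
move=> ->; rewrite -subr_le0; have [_ /(_ (zeta N x xd om u))] := LMI.
rewrite -/(bil _ _ _) !bil_mxD bil_mxN bil_symmx bil_mulmx.
by rewrite bil_M0_zeta bil_M1_zeta bil_Gamma_zeta.
Qed.

(** The storage minus a primitive of the supply is nonincreasing. Its derivative is needed only
    inside []t0, t1[], so continuity suffices at [t0 = 0], where [X'] may jump. *)
Lemma dissipation Pi t0 t1 : energy_primitive Pi -> 0 <= t0 -> t0 <= t1 ->
  storage_at Pi t1 - storage_at Pi t0 <=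
  \int[mu]_(s in `[t0, t1]) quadratic_supply S11 S12 S22 (C *m X s) (U s).
Proof.
move=> ePi t0_ge0 t01.
have cs : continuous (fun s => quadratic_supply S11 S12 S22 (C *m X s) (U s)).
  by apply: continuous_quadratic_supply_col => //; exact: continuous_mulmx.
have [Q dQ] := primitive_exists cs.
have cQ : continuous Q by move=> s; exact: is_derive_continuous (dQ s).
rewrite (continuous_Rintegral t01 cs cQ (fun s _ => dQ s)).
have cTh i : continuous (fun s => bil (Theta i) (X s) (X s)) by exact: continuous_bil.
pose W s := storage_at Pi s - Q s.
suff : W t1 <= W t0 by rewrite /W; lra.
pose w s := bil P (H_mx N A Ad B *m zeta_at s) (state_at s) +
  bil P (state_at s) (H_mx N A Ad B *m zeta_at s) +
  \sum_i (bil (Theta i) (X s) (X s) - bil (Theta i) (X (s - tau i)) (X (s - tau i))) +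
  \sum_i (tau i ^+ 2 * rho i s - tau i * (Pi i s - Pi i (s - tau i))) -
  quadratic_supply S11 S12 S22 (C *m X s) (U s).
apply: (@derive_le _ W w t0 t1) => //.
- have c1 := @continuous_bil _ _ _ _ P _ _ continuous_state continuous_state.
  have c2 := continuous_sumr (fun i => continuous_window (p := 1) (ltW (tau0 i)) (cTh i)).
  have c3 : continuous
      (fun s => \sum_i tau i * (tau i * Pi i s - window (tau i) 1 (Pi i) s)).
    have cc (d : R) : continuous (fun _ : R => d) by move=> s; exact: cst_continuous.
    apply: continuous_sumr => i; apply: continuous_mul => //.
    have [cPi _ _] := ePi i.
    have cP1 := continuous_mul (cc (tau i)) cPi.
    have cP2 := continuous_window (p := 1) (ltW (tau0 i)) cPi.
    by move=> s; exact: continuousB (cP1 s) (cP2 s).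
  by move=> s; exact: continuousB (continuousD (continuousD (c1 s) (c2 s)) (c3 s)) (cQ s).
- move=> s /andP[t0s _]; have s0 : 0 < s by exact: le_lt_trans t0s.
  have d1 := is_derive_bil P (is_derive_state s0) (is_derive_state s0).
  have d2 : is_derive s 1
      (fun s => \sum_i window (tau i) 1 (fun s => bil (Theta i) (X s) (X s)) s)
      (\sum_i (bil (Theta i) (X s) (X s) -
               bil (Theta i) (X (s - tau i)) (X (s - tau i)))).
    apply: is_derive_sumr => i.
    have := is_derive_window 1 s (ltW (tau0 i)) (cTh i).
    by rewrite derivC window0 !hornerC !mul1r subr0.
  have d3 : is_derive s 1
      (fun s => \sum_i tau i * (tau i * Pi i s - window (tau i) 1 (Pi i) s))
      (\sum_i (tau i ^+ 2 * rho i s - tau i * (Pi i s - Pi i (s - tau i)))).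
    apply: is_derive_sumr => i; have [cPi _ /(_ _ s0) dPi] := ePi i.
    have dw := is_derive_window 1 s (ltW (tau0 i)) cPi.
    apply: is_derive_eq.
    by rewrite derivC window0 !hornerC /rho /GRing.scale /=; ring.
  have dQs := dQ s.
  rewrite /W /storage_at.
  exact: is_deriveB (is_deriveD (is_deriveD d1 d2) d3) dQs.
- move=> s /andP[t0s _]; have s0 : 0 < s by exact: le_lt_trans t0s.
  have := LMI_zeta (erefl (zeta_at s)).
  rewrite F_zeta_at G_zeta_at.
  (* The increments of [Pi i] that leave the energy term dominate the Gamma form on the right of
     [LMI_zeta]; symmetry of [P] merges the two derivative terms into the factor [2]. *)
  have bessel : \sum_i \sum_(k < N.+1) (2 * k + 1)%:R *
      bil (Rm i) (Gamma_row R n m N i k *m zeta_at s) (Gamma_row R n m N i k *m zeta_at s)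
      <= \sum_i tau i * (Pi i s - Pi i (s - tau i)).
    apply: ler_sum => i _; under eq_bigr do rewrite Gamma_zeta_at.
    have [cPi dPi1 dPi2] := ePi i; have /andP[_ tih] := tauh i.
    apply: (@bessel_legendre _ _ _ _ _ _ X y rhs) => // s'.
    + move=> ts' s'0; apply: dX1 => //; apply: lt_trans ts'; lra.
    + by move=> _; exact: dX2.
  move=> /le_trans/(_ bessel); rewrite /w sumrB (psd_bilC _ (state_at s) psdP) /rho.
  rewrite !sumrB.
  lra.
Qed.

(** On []- h, +oo[] the derivative of [x] is [y] before time [0] and [rhs] after it. Its value at
    [0] is unknown but sits at a single point of the window, which [kink_moment] permits. *)
Lemma storage_along Pi x t : energy_primitive Pi -> 0 <= t ->
    (forall s, - h <= s -> x s = X s) ->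
  storage tau Theta Rm P (fun s => x (t + s)) = storage_at Pi t.
Proof.
move=> ePi t0 xX; rewrite /storage /storage_at.
have xXt i s : s \in `[- tau i, 0] -> x (t + s) = X (t + s).
  rewrite in_itv /= => /andP[ts _]; apply: xX; have /andP[_ tih] := tauh i; lra.
have dx s : - h < s -> deriv_col x s = deriv_col X s.
  move=> hs; apply: eq_deriv_col; near=> r; apply: xX; apply: ltW.
  by near: r; exact: lt_nbhsr.
have -> : storage_state N tau (fun s => x (t + s)) = state_at t.
  rewrite /storage_state addr0 xX; last by rewrite (le_trans _ t0)// oppr_le0.
  congr col_mx; apply/eq_mxcol => i; apply/eq_mxcol => k; apply/colP => a.
  by rewrite !mxE; apply: eq_moment => s /xXt ->.
have e2 i : \int[mu]_(s in `[- tau i, 0]) bil (Theta i) (x (t + s)) (x (t + s)) =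
    window (tau i) 1 (fun s => bil (Theta i) (X s) (X s)) t.
  by apply: eq_Rintegral => s; rewrite inE => /xXt ->; rewrite hornerC mul1r.
have e3 i : \int[mu]_(s in `]- tau i, 0[) ((tau i + s) *
      bil (Rm i) (deriv_col (fun r => x (t + r)) s) (deriv_col (fun r => x (t + r)) s)) =
    tau i * Pi i t - window (tau i) 1 (Pi i) t.
  have [cPi d1 d2] := ePi i; have /andP[_ tih] := tauh i.
  under eq_Rintegral do rewrite deriv_col_translate.
  apply: (@kink_moment _ _ (fun s => bil (Rm i) (deriv_col x s) (deriv_col x s))
    _ _ _ _ (ltW (tau0 i)) _ _ cPi d1 d2).
  - exact: continuous_bil.
  - by apply: continuous_bil; exact: continuous_rhs.
  - move=> s ts s0; have hs : - h < s by lra.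
    by rewrite dx// (deriv_colE (dX1 hs s0)).
  - move=> s s0; have hs : - h < s.
      by apply: lt_trans s0; rewrite oppr_lt0 (lt_le_trans (tau0 i)).
    by rewrite dx// (deriv_colE (dX2 s0)).
rewrite (eq_bigr _ (fun i _ => e2 i)).
by under [X in _ + X = _]eq_bigr do rewrite e3.
Unshelve. all: by end_near. Qed.

End Trajectory.

(** * Extension of the solution to the whole line, and dissipativity *)

Theorem corollary2 (R : realType) (q n m N : nat)
    (n_gt0 : (0 < n)%N) (m_gt0 : (0 < m)%N)
    (tau : 'I_q.+1 -> R) (tau_gt0 : 0 < tau ord0)
    (tau_homo : forall i j : 'I_q.+1, (i <= j)%N -> tau i <= tau j)
    (A : 'M[R]_n) (Ad : 'I_q.+1 -> 'M[R]_n) (B : 'M[R]_(n, m))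
    (C : 'M[R]_(m, n)) (S11 S12 S22 : 'M[R]_m)
    (S11_sym : S11^T = S11) (S22_sym : S22^T = S22) :
  (exists (Theta Rm : 'I_q.+1 -> 'M[R]_n)
          (P : 'M[R]_(n + omega_dim q.+1 N n)),
     [/\ forall i, psdmx (Theta i),
         forall i, psdmx (Rm i),
         psdmx P &
         nsdmx (2 *: symmx ((G_mx n m N tau)^T *m P *m H_mx N A Ad B)
                + M0_mx N Theta C S11 S12 S22
                + M1_mx N tau A Ad B Rm
                - (Gamma_mx R q.+1 n m N)^T *m Rdiag_mx N Rm
                    *m Gamma_mx R q.+1 n m N)]) ->
  dissipative tau A Ad B C (quadratic_supply S11 S12 S22).
Proof.
move=> [ Theta [Rm [P [psdT psdR psdP LMI]]]].
split; first exact: continuous_quadratic_supply.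
pose h := tau ord_max.
have tauh i : 0 < tau i <= h.
  by rewrite (lt_le_trans tau_gt0) ?tau_homo// -ltnS.
have h0 : 0 < h by case/andP: (tauh ord_max).
exists (storage tau Theta Rm P); split.
  exact: storage_is_functional (ltW h0) tauh psdP psdT psdR.
move=> phi u x [g cg dg] cu [cx xphi _ dx] t0 t1 t0_ge0 t01.
have cmax (c : R) : continuous (fun s : R => Num.max s c).
  by move=> s; apply: continuous_max => //; exact: cst_continuous.
have cmin (c : R) : continuous (fun s : R => Num.min s c).
  by move=> s; apply: continuous_min => //; exact: cst_continuous.
(* Clamping the argument into the interval where [x], [g] or [u] is controlled gives globally
   continuous curves that agree with the originals there. *)
pose X (s : R) := x (Num.max s (- h)).
pose y (s : R) := g (Num.max (Num.min s 0) (- h)).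
pose U (s : R) := u (Num.max s 0).
have cX : continuous_col X.
  apply: continuous_coord; apply: continuous_retract cx => // s /=.
  by rewrite in_itv /= andbT le_max lexx orbT.
have cy : continuous_col y.
  have cc : continuous (fun s : R => Num.max (Num.min s 0) (- h)).
    by move=> s; exact: (continuous_comp (cmin 0 s) (cmax (- h) _)).
  apply: continuous_coord; apply: continuous_retract cc _ cg => s /=.
  by rewrite in_itv /= le_max lexx orbT ge_max ge_min lexx orbT oppr_le0 ltW.
have cU : continuous_col U.
  apply: continuous_coord; apply: continuous_retract cu => // s /=.
  by rewrite in_itv /= andbT le_max lexx orbT.
have xX s : - h <= s -> x s = X s by move=> hs; rewrite /X max_l.
have dX1 s : - h < s -> s < 0 -> is_derive_col s X (y s).
  move=> hs s0.
  have -> : y s = g s by rewrite /y min_l ?max_l ?ltW.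
  apply: (@near_eq_is_derive_col _ _ phi).
    near=> r; rewrite -xX; last by apply: ltW; near: r; exact: lt_nbhsr.
    rewrite xphi// in_itv /= !ltW//; near: r; by [exact: lt_nbhsl|exact: lt_nbhsr].
  apply: (is_derive_in_col (D := `[- h, 0])).
    near=> r; rewrite /= in_itv /= !ltW//; near: r; by [exact: lt_nbhsl|exact: lt_nbhsr].
  by apply: dg; rewrite /= in_itv /= !ltW.
have dX2 s : 0 < s -> is_derive_col s X (rhs tau A Ad B X U s).
  move=> s0; apply: (@near_eq_is_derive_col _ _ x).
    near=> r; apply: xX; apply: ltW; near: r; apply: lt_nbhsr.
    by rewrite (lt_trans _ s0)// oppr_lt0.
  apply: (is_derive_in_col (D := `[0, +oo[)).
    by near=> r; rewrite /= in_itv /= andbT ltW//; near: r; exact: lt_nbhsr.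
  have := dx s (ltW s0); congr (is_derive_in _ _ _ _).
  rewrite /rhs /U max_l ?ltW// -xX; last by rewrite (le_trans _ (ltW s0))// oppr_le0 ltW.
  congr (_ + _ + _); apply: eq_bigr => i _; rewrite -xX//.
  by have /andP[_ tih] := tauh i; lra.
have [Pi ePi] := energy_primitive_exists tau Rm A Ad B cX cy cU.
have t1_ge0 := le_trans t0_ge0 t01.
rewrite !(storage_along Theta P (ltW h0) tauh cX cy cU dX1 dX2 ePi _ xX)//.
have -> : \int[lebesgue_measure]_(r in `[t0, t1])
    quadratic_supply S11 S12 S22 (C *m x r) (u r) =
    \int[lebesgue_measure]_(r in `[t0, t1])
    quadratic_supply S11 S12 S22 (C *m X r) (U r).
  apply: eq_Rintegral => s; rewrite inE /= in_itv /= => /andP[t0s _].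
  have s0 := le_trans t0_ge0 t0s.
  by rewrite /U max_l// -xX// (le_trans _ s0)// oppr_le0 ltW.
exact: dissipation ePi t0_ge0 t01.
Unshelve. all: by end_near. Qed.
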